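(* Let $\alpha\in\left(\frac13,2\right]$, let $c_0\in(-1,\infty)$ be fixed, let $\psi_0$ be a ground-state wave with speed $c_0$, and let $\mathcal L=D^\alpha+c_0-2\psi_0$. Assume ${\rm Ker}(\mathcal L|_{X_0})={\rm span}(\partial_x\psi_0)$. Then there exists a unique continuation of $\psi_0$ by even solutions of the boundary-value problem $$D^\alpha\psi+c\psi=\Pi_0\psi^2,\qquad\psi\in H^\alpha_{\rm per}(\mathbb T)\cap X_0,$$ in an open interval $\mathcal I_c\subset(-1,\infty)$ containing $c_0$, such that the mapping $$\mathcal I_c\ni c\mapsto\psi(\cdot,c)\in H^\alpha_{\rm per}(\mathbb T)\cap X_0$$ is $C^1$ and $\psi(\cdot,c_0)=\psi_0$.
   Context: $\mathbb T=[-\pi,\pi]$ with periodic boundary conditions; functions are real-valued and $2\pi$-periodic. $D^\alpha$ is the Fourier multiplier $\widehat{D^\alpha g}(m)=|m|^\alpha\widehat g(m)$, $m\in\mathbb Z$. $\Pi_0f:=f-\frac1{2\pi}\int_{-\pi}^{\pi}f\,dx$ and $X_0:=\{f\in L^2_{\rm per}(\mathbb T):\int_{-\pi}^{\pi}f\,dx=0\}$. A profile is single-lobe if it has only one maximum and only one minimum on $\mathbb T$, with the maximum placed at $x=0$. Ground-state wave with speed $c_0$: an even, single-lobe, zero-mean solution $\psi_0\in H^\infty_{\rm per}(\mathbb T)$ of $D^\alpha\psi_0+c_0\psi_0=\Pi_0\psi_0^2$ of the form $\psi_0=C_1\phi$, $C_1=\int_{-\pi}^{\pi}[(D^{\alpha/2}\phi)^2+c_0\phi^2]dx$,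 where $\phi$ minimizes $\int_{-\pi}^{\pi}[(D^{\alpha/2}u)^2+c_0u^2]dx$ over all $u\in H^{\alpha/2}_{\rm per}(\mathbb T)$ with $\int_{-\pi}^{\pi}u^3dx=1$ and $\int_{-\pi}^{\pi}u\,dx=0$. $\mathcal L$ is self-adjoint in $L^2_{\rm per}(\mathbb T)$ with domain $H^\alpha_{\rm per}(\mathbb T)$; $\mathcal L|_{X_0}=\Pi_0\mathcal L\Pi_0$ is regarded as an operator in $X_0$, i.e. $\mathcal L|_{X_0}f=\Pi_0\mathcal Lf$ for $f\in H^\alpha_{\rm per}(\mathbb T)\cap X_0$. *)

(* Defs.v *)
From HB Require Import structures.
From mathcomp Require Import all_boot all_order all_algebra.
From mathcomp Require Import all_classical all_reals all_analysis.
From mathcomp Require Import complex.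

Set Implicit Arguments.
Unset Strict Implicit.
Unset Printing Implicit Defensive.

Import Order.TTheory GRing.Theory Num.Theory.
Import numFieldNormedType.Exports.

Local Open Scope classical_set_scope.
Local Open Scope complex_scope.
Local Open Scope ring_scope.

(* Functions on the torus are 2pi-periodic functions R -> R. Elements of L^2
   and H^s are represented by functions, and identities between them are
   stated almost everywhere on [-pi, pi] (equivalently, by periodicity,
   almost everywhere on R). *)
Section Torus.
Context {R : realType}.
Implicit Types (f g psi phi u : R -> R) (s alpha c : R) (m : int).

Local Notation mu := (@lebesgue_measure R).

Definition torus : set R := `[- pi, pi].

Definition tint f : R := \int[mu]_(x in torus) f x.

Definition eqae f g : Prop := ae_eq mu torus f g.

Definition L2per f : Prop :=
  [/\ measurable_fun setT f, periodic f (2 * pi) &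
      mu.-integrable torus (fun x => (f x ^+ 2)%:E)].

Definition fourier f m : R[i] :=
  ((2 * pi)^-1 * tint (fun x => f x * cos (m%:~R * x))) +i*
  (- ((2 * pi)^-1 * tint (fun x => f x * sin (m%:~R * x)))).

Definition sobolev_sum s f : \bar R :=
  (\esum_(m in [set: int])
     (((1 + m%:~R ^+ 2) `^ s * Normc.normc (fourier f m) ^+ 2)%:E))%E.

Definition Hper s f : Prop := L2per f /\ (sobolev_sum s f < +oo)%E.

Definition Hnorm s f : R := Num.sqrt (fine (sobolev_sum s f)).

(* An element of the intersection of all H^s is a class of functions; it is
   identified with its unique continuous representative, so that evenness,
   extrema and the classical derivative make sense pointwise. *)
Definition Hper_infty f : Prop := (forall s, Hper s f) /\ continuous f.

Definition X0 f : Prop := L2per f /\ tint f = 0.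

Definition Pi0 f : R -> R := fun x => f x - (2 * pi)^-1 * tint f.

(* The element of L^2 with Fourier coefficients |m|^s f^(m); for s >= 0 it
   exists exactly when f is in H^s, and is unique up to [eqae]. For s > 0 the
   coefficient at m = 0 is killed since 0 `^ s = 0. *)
Definition Dpow s f : R -> R :=
  xget (fun=> 0) [set g | L2per g /\
    forall m, fourier g m = (`|m%:~R| `^ s)%:C * fourier f m].

Definition solves alpha c psi : Prop :=
  [/\ Hper alpha psi, X0 psi &
      eqae (fun x => Dpow alpha psi x + c * psi x)
           (Pi0 (fun x => psi x ^+ 2))].

Definition quad alpha c u : R :=
  tint (fun x => Dpow (alpha / 2) u x ^+ 2 + c * u x ^+ 2).

Definition admissible alpha u : Prop :=
  [/\ Hper (alpha / 2) u, tint (fun x => u x ^+ 3) = 1 & tint u = 0].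

Definition minimizer alpha c phi : Prop :=
  admissible alpha phi /\
  forall u, admissible alpha u -> quad alpha c phi <= quad alpha c u.

Definition local_max f (x : R) : Prop := \forall y \near x, f y <= f x.
Definition local_min f (x : R) : Prop := \forall y \near x, f x <= f y.

(* ]-pi, pi] contains each point of the torus exactly once. *)
Definition single_lobe f : Prop :=
  (forall x : R, x \in `]- pi, pi] -> (local_max f x <-> x = 0)) /\
  (exists! x : R, x \in `]- pi, pi] /\ local_min f x).

Definition ground_state alpha c psi : Prop :=
  [/\ Hper_infty psi, (forall x, psi (- x) = psi x), single_lobe psi,
      solves alpha c psi &
      exists2 phi, minimizer alpha c phi &
        eqae psi (fun x => quad alpha c phi * phi x)].

Definition Lop alpha c psi f : R -> R :=
  fun x => Dpow alpha f x + c * f x - 2 * psi x * f x.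

Definition kerLX0 alpha c psi f : Prop :=
  [/\ Hper alpha f, X0 f & eqae (Pi0 (Lop alpha c psi f)) (fun=> 0)].

Definition even_ae f : Prop := eqae (fun x => f (- x)) f.

(* F is continuously differentiable on the open set I as a map into
   H^s \cap X_0 with the H^s norm. *)
Definition C1_HX0 s (I : set R) (F : R -> R -> R) : Prop :=
  (forall c, I c -> Hper s (F c) /\ X0 (F c)) /\
  exists dF : R -> R -> R, forall c, I c ->
    [/\ Hper s (dF c) /\ X0 (dF c),
        Hnorm s (fun x => h^-1 * (F (c + h) x - F c x) - dF c x)
          @[h --> 0^'] --> (0 : R) &
        Hnorm s (fun x => dF b x - dF c x) @[b --> c] --> (0 : R)].

Definition even_branch alpha c0 psi0 (I : set R) (psi : R -> R -> R) : Prop :=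
  [/\ forall c, I c -> solves alpha c (psi c) /\ even_ae (psi c),
      C1_HX0 alpha I psi & eqae (psi c0) psi0].

End Torus.

(* Main.v *)
(* An even zero-mean f = sum_(m >= 1) b_m cos(m t) lies in H^alpha iff
   x_m = m^alpha b_m is square summable. In terms of x the equation reads
   x + c A x - B(x, x) = 0 in l^2, where A multiplies by m^-alpha and B is the
   weighted convolution coming from the product of cosine series; B is bounded
   on l^2 since sum m^(-4 alpha) < +oo. At the ground state x0 the linearization
   1 + c0 A - 2 B(x0, .) is a compact perturbation of the identity. It is
   injective, because the kernel of L on X_0 is spanned by the derivative of
   psi_0, which is odd. Hence it is invertible, and the contraction principle
   gives a unique local branch, which is C^1 in c. Riesz-Fischer and the
   uniqueness of Fourier coefficients carry the branch back to functions. *)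
From HB Require Import structures.
Require Import Defs.
From mathcomp Require Import all_boot all_order all_algebra.
From mathcomp Require Import all_classical all_reals all_analysis.
From mathcomp Require Import measurable_realfun complex zify ring lra.

Import Order.TTheory GRing.Theory Num.Theory.
Import numFieldNormedType.Exports.

Local Open Scope classical_set_scope.
Local Open Scope ring_scope.

Set Implicit Arguments.
Unset Strict Implicit.
Unset Printing Implicit Defensive.

(** * Quadratic equations in Banach spaces *)

(** Sequences rather than classes of functions carry the analysis because [l2] is a genuine complete
    normed space, whereas [Hnorm] acts on functions taken modulo equality almost everywhere.
    Compactness enters only as smallness: beyond the first [N] modes the perturbation has norm at
    most [1/2], so inverting the linearization amounts to a Neumann series and an [N] by [N] matrix.
    Since the equation is quadratic, differences of its values are given exactly by a linear
    operator, and existence, differentiability and continuity of the derivative all come from one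
    bound on that operator. On the side of functions, the square of an L^2 function is only known to
    be integrable. The equation therefore has to be recovered from Fourier coefficients in L^1,
    which is why uniqueness of coefficients rests on Lebesgue differentiation and not on L^2
    completeness. The operator [Dpow] is accessible only through its coefficients as well. *)

Section LinearMaps.
Context {R : pzRingType} {V W : lmodType R} (f : V -> W).
Hypothesis fl : linear f.

Let g : {linear V -> W} :=
  HB.pack_for {linear V -> W} f (GRing.isLinear.Build R V W *:%R f fl).

Lemma linD x y : f (x + y) = f x + f y. Proof. exact: (raddfD g). Qed.
Lemma linB x y : f (x - y) = f x - f y. Proof. exact: (raddfB g). Qed.
Lemma linN x : f (- x) = - f x. Proof. exact: (raddfN g). Qed.
Lemma lin0 : f 0 = 0. Proof. exact: (raddf0 g). Qed.
Lemma linZ a x : f (a *: x) = a *: f x. Proof. exact: (linearZ_LR g). Qed.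
Lemma lin_sum I (r : seq I) (P : pred I) (F : I -> V) :
  f (\sum_(i <- r | P i) F i) = \sum_(i <- r | P i) f (F i).
Proof. exact: (raddf_sum g). Qed.

End LinearMaps.

Section FixedPoints.
Context {R : realType} {V : completeNormedModType R}.

Lemma ball_fixed_point (f : V -> V) (q r : R) : 0 <= q < 1 -> 0 <= r ->
  (forall x, `|x| <= r -> `|f x| <= r) ->
  (forall x y, `|x| <= r -> `|y| <= r -> `|f x - f y| <= q * `|x - y|) ->
  exists2 x, `|x| <= r & f x = x.
Proof.
move=> /andP[q0 q1] r0 fr fc; pose U : set V := [set x | `|x| <= r].
have fU : {homo f : x / U x >-> U x} by move=> x; exact: fr.
have cU : closed U.
  have -> : U = closed_ball_ (fun x : V => `|x|) 0 r.
    by apply/seteqP; split=> x /=; rewrite /closed_ball_ /= sub0r normrN.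
  exact: closed_closed_ball_.
have [||p Up pE] := @banach_fixed_point R V U (mkfun_fun fU) _ cU.
- exists (NngNum q0); split=> //= -[x y] [/= Ux Uy]; exact: fc.
- by exists 0; rewrite /U /= normr0.
by exists p.
Qed.

(** The bound [(1 - q) |x| <= |x + N x|] gives injectivity and the norm of the inverse. Surjectivity
    is the fixed point of [x = y - N x]. The inverse is chosen pointwise, and injectivity makes it
    linear. *)
Lemma neumann (N : V -> V) (q : R) : linear N -> 0 <= q < 1 ->
  (forall x, `|N x| <= q * `|x|) ->
  [/\ forall x, x + N x = 0 -> x = 0 &
   exists T : V -> V, [/\ linear T, forall y, T y + N (T y) = y &
     forall y, `|T y| <= (1 - q)^-1 * `|y|] ].
Proof.
move=> Nl /andP[q0 q1] Nq; have q1' : 0 < 1 - q by rewrite subr_gt0.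
have bnd x : `|x| <= (1 - q)^-1 * `|x + N x|.
  rewrite ler_pdivlMl// mulrBl mul1r.
  have := ler_normB (x + N x) (N x); rewrite addrK => h.
  by have := Nq x; lra.
have inj x : x + N x = 0 -> x = 0.
  by move=> h; apply/normr0_eq0/le_anti; rewrite normr_ge0 (le_trans (bnd x))// h normr0 mulr0.
have ex y : {x | x + N x = y}.
  (* This radius solves [r = |y| + q r], so the map [x |-> y - N x] preserves the ball. *)
  apply: cid; pose r := (1 - q)^-1 * `|y|.
  have [||||x _ xE] := @ball_fixed_point (fun x => y - N x) q r.
  - by rewrite q0.
  - by rewrite mulr_ge0// invr_ge0 ltW.
  - move=> x xr; rewrite (le_trans (ler_normB _ _))// (le_trans (lerD (lexx _) (Nq x)))//.
    have -> : r = `|y| + q * r by rewrite /r; field; rewrite gt_eqF.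
    by rewrite lerD2l ler_wpM2l.
  - by move=> x y' _ _; rewrite opprB addrC addrA subrK -linB// -[`|x - y'|]distrC.
  - by exists x; rewrite -{1}xE subrK.
split=> //; exists (fun y => sval (ex y)).
have TE y : sval (ex y) + N (sval (ex y)) = y by case: (ex y).
split=> // [a x y|y]; last by rewrite (le_trans (bnd _))// TE.
apply/subr0_eq/inj => /=; rewrite (linB Nl) (linD Nl) (linZ Nl).
by rewrite addrACA -opprD TE [X in _ - X]addrACA -scalerDr !TE subrr.
Qed.

(* [1 + N] is invertible by a Neumann series, and the remaining finite-rank
   part [K \o P] is inverted by a matrix computation. *)
Lemma compact_perturbation_inverse (K : V -> V) (n : nat) (l : 'I_n -> V -> R)
    (e : 'I_n -> V) (q L : R) (P := fun x => \sum_i l i x *: e i) :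
  linear K -> (forall i, linear (l i : V -> R^o)) ->
  (forall i x, `|l i x| <= L * `|x|) -> 0 <= q < 1 ->
  (forall x, `|K (x - P x)| <= q * `|x|) ->
  (forall x, x + K x = 0 -> x = 0) ->
  exists (S : V -> V) (s : R), [/\ 0 < s, linear S,
    forall y, S y + K (S y) = y, forall x, S (x + K x) = x &
    forall y, `|S y| <= s * `|y|].
Proof.
move=> Kl ll lL q01 Kq Kinj.
have Pl : linear P.
  move=> a x y; rewrite /P scaler_sumr -big_split/=; apply: eq_bigr => i _.
  by rewrite ll scalerDl scalerA.
pose N x := K (x - P x).
have Nl : linear N.
  move=> a x y; rewrite /N Pl -Kl; congr K.
  by rewrite scalerBr opprD addrACA.
have KE x : K x = N x + \sum_i l i x *: K (e i).
  rewrite -[in LHS](subrK (P x) x) (linD Kl); congr (_ + _).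
  by rewrite /P (lin_sum Kl); apply: eq_bigr => i _; exact: linZ.
have [_ [T [Tl TE Tb]]] := neumann Nl q01 Kq.
(* If [x + K x = y], then [x = T (y - sum_i t_i K e_i)] with [t_i = l_i x]. Applying each [l_j]
   gives the row system [t M = (l_j (T y))_j]. *)
pose M : 'M[R]_n := \matrix_(i, j) ((i == j)%:R + l j (T (K (e i)))).
have lsum j (t : 'I_n -> R) :
    l j (T (\sum_i t i *: K (e i))) = \sum_i t i * l j (T (K (e i))).
  rewrite lin_sum// lin_sum//; apply: eq_bigr => i _.
  by rewrite linZ// (linZ (ll j)).
have tM (t : 'rV[R]_n) j :
    (t *m M) 0 j = t 0 j + l j (T (\sum_i t 0 i *: K (e i))).
  rewrite lsum mxE; under eq_bigr do rewrite mxE mulrDr.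
  rewrite big_split/= (bigD1 j)//= eqxx mulr1 big1 ?addr0// => i /negbTE ->.
  by rewrite mulr0.
(* A row [t] annihilated by [M] yields the element [- T (sum_i t_i K e_i)] of the kernel of [1 + K].
   It vanishes by [Kinj], and then so does [t]. *)
have Mu : M \in unitmx.
  rewrite -row_free_unit -kermx_eq0; apply/eqP/row_matrixP => k.
  rewrite row0; set t := row k _.
  have tM0 : t *m M = 0 by rewrite -row_mul mulmx_ker row0.
  pose y := \sum_i t 0 i *: K (e i).
  have ty j : t 0 j = - l j (T y).
    by apply/eqP; rewrite -addr_eq0 -tM tM0 mxE.
  have /eqP : - T y = 0.
    apply: Kinj; rewrite KE (linN Nl) addrA -opprD TE -[X in - X + _]/y.
    rewrite addrC; apply/eqP; rewrite subr_eq0; apply/eqP/eq_bigr => i _.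
    by rewrite ty (linN (ll i)).
  rewrite oppr_eq0 => /eqP Ty0; apply/rowP => j.
  by rewrite ty Ty0 (lin0 (ll j)) oppr0 mxE.
pose t y : 'rV[R]_n := (\row_j l j (T y)) *m invmx M.
pose S y := T (y - \sum_i t y 0 i *: K (e i)).
have SE y : S y + K (S y) = y.
  have lS j : l j (S y) = t y 0 j.
    rewrite /S linB// (linB (ll j)); apply/eqP; rewrite subr_eq -tM.
    by rewrite /t mulmxKV// mxE.
  rewrite KE addrA TE; under [X in _ + X]eq_bigr do rewrite lS.
  by rewrite subrK.
have SE' x : S (x + K x) = x.
  apply/subr0_eq/Kinj; rewrite (linB Kl) addrACA -opprD SE subrr//.
pose c := (1 - q)^-1.
have c0 : 0 <= c by rewrite invr_ge0; case/andP: q01 => ? ?; lra.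
have tb y j : `|t y 0 j| <= (\sum_i `|L| * c * `|invmx M i j|) * `|y|.
  rewrite mxE (le_trans (ler_norm_sum _ _ _))// mulr_suml ler_sum// => i _.
  rewrite mxE normrM mulrAC ler_wpM2r// (le_trans (lL i _))//.
  rewrite (le_trans (ler_wpM2r _ (ler_norm L)))// -mulrA ler_wpM2l//.

pose s0 := \sum_j (\sum_i `|L| * c * `|invmx M i j|) * `|K (e j)|.
exists S, (c * (1 + s0) + 1); split=> //.
- rewrite ltr_wpDl// mulr_ge0// addr_ge0// sumr_ge0// => j _.
  by rewrite mulr_ge0// sumr_ge0// => i _; rewrite !mulr_ge0.
- move=> a x y; rewrite -[RHS]SE'; congr S.
  by rewrite (linD Kl) (linZ Kl) addrACA -scalerDr !SE.
- move=> y; rewrite (le_trans (Tb _))// (@le_trans _ _ (c * (1 + s0) * `|y|))//.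
    rewrite -mulrA ler_wpM2l// mulrDl mul1r (le_trans (ler_normB _ _))// lerD2l.
    rewrite (le_trans (ler_norm_sum _ _ _))// mulr_suml ler_sum// => j _.
    by rewrite normrZ mulrAC ler_wpM2r.
  by rewrite ler_wpM2r// lerDl.
Qed.

End FixedPoints.

(** * Local branches of a quadratic equation *)

Section QuadraticEquation.
Context {R : realType} {V : completeNormedModType R}.
Variables (A : V -> V) (B : V -> V -> V) (a b : R).
Hypotheses (Al : linear A) (Bl : forall x, linear (B x))
  (Br : forall y, linear (B^~ y)).
Hypotheses (a0 : 0 <= a) (Aa : forall x, `|A x| <= a * `|x|).
Hypotheses (b0 : 0 <= b) (Bb : forall x y, `|B x y| <= b * `|x| * `|y|).

Definition quadratic_eq (c : R) (x : V) := x + c *: A x - B x x.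

Variables (c0 : R) (x0 : V) (S : V -> V) (s : R).
Hypotheses (Gx0 : quadratic_eq c0 x0 = 0) (Sl : linear S) (s0 : 0 < s).
Hypotheses (Ss : forall y, `|S y| <= s * `|y|)
  (TS : forall y, S y + (c0 *: A (S y) - (B x0 (S y) + B (S y) x0)) = y)
  (ST : forall x, S (x + (c0 *: A x - (B x0 x + B x x0))) = x).

Let BlD x y z : B (x + y) z = B x z + B y z. Proof. exact: (linD (Br z)). Qed.
Let BlB x y z : B (x - y) z = B x z - B y z. Proof. exact: (linB (Br z)). Qed.
Let BrD z x y : B z (x + y) = B z x + B z y. Proof. exact: (linD (Bl z)). Qed.
Let BrB z x y : B z (x - y) = B z x - B z y. Proof. exact: (linB (Bl z)). Qed.

(** Exact divided difference of [arg d] between [y] and [y']; at [y = y'] it is the derivative. Here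
    [arg (c - c0) y] is what remains of the equation at [x0 + y] once the linearization at
    [(c0, x0)] is split off. *)
Let F d y y' w := B y w + B w y' - d *: A w.
Let arg d y := B y y - d *: A (x0 + y).

Let Fl d y y' : linear (F d y y').
Proof.
move=> k u v; rewrite /F (linD (Bl y)) (linZ (Bl y)) (linD (Br y')) (linZ (Br y')).
rewrite (linD Al) (linZ Al) !scalerDr scalerN addrACA.
by rewrite opprD [LHS]addrACA !scalerA [d * k]mulrC.
Qed.

Let scaleA_diff d d' u u' :
  d *: A u - d' *: A u' = d *: A (u - u') + (d - d') *: A u'.
Proof. by rewrite (linB Al) scalerBr scalerBl addrA subrK. Qed.

Let arg_diff d d' y y' :
  arg d y - arg d' y' = F d y y' (y - y') - (d - d') *: A (x0 + y').
Proof.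
rewrite /arg /F opprD addrACA -opprD scaleA_diff.
have -> : x0 + y - (x0 + y') = y - y' by rewrite opprD addrACA subrr add0r.
by rewrite opprD addrA BrB BlB [in RHS]addrA subrK.
Qed.

(** For fixed [w] the operator is jointly linear in its other arguments, so its variation along the
    branch obeys the same estimate [SF]. *)
Let F_diff d d' y y' z z' w :
  F d y z w - F d' y' z' w = F (d - d') (y - y') (z - z') w.
Proof.
rewrite /F BlB BrB scalerBl !opprD !opprK [LHS]addrACA; congr (_ + _).
exact: addrACA.
Qed.

Let quadratic_eqE c y : quadratic_eq c (x0 + y) =
  y + (c0 *: A y - (B x0 y + B y x0)) - arg (c - c0) y.
Proof.
rewrite -[LHS](subr0) -Gx0 /quadratic_eq /arg !BlD !BrD !(linD Al).
rewrite !scalerDr !scalerBl !opprD !opprK !addrA.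
rewrite [LHS](ACl ((1*9)*(11*5)*(2*3*4*6*7*8*10)))/= !subrr !add0r.
by rewrite [RHS](ACl ((9*2)*(1*6*8*3*4*5*7)))/= addNr add0r.
Qed.

Let quadratic_fixP c y : quadratic_eq c (x0 + y) = 0 <-> S (arg (c - c0) y) = y.
Proof.
rewrite quadratic_eqE; split=> [/subr0_eq <-|h]; first exact: ST.
by apply/eqP; rewrite subr_eq0 -{1 2 3 4}h TS.
Qed.

Let SF d y y' w :
  `|S (F d y y' w)| <= s * (b * `|y| + b * `|y'| + a * `|d|) * `|w|.
Proof.
rewrite (le_trans (Ss _))// -mulrA ler_pM2l// !mulrDl.
rewrite (le_trans (ler_normB _ _))// lerD//.
  rewrite (le_trans (ler_normD _ _))// lerD// ?(le_trans (Bb _ _))//.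
  by rewrite mulrAC.
by rewrite normrZ [a * _]mulrC -mulrA ler_wpM2l.
Qed.

(* With [S] the inverse of the linearization at [(c0, x0)], the equation for
   [y = x - x0] is the fixed point problem [y = S (B y y - (c - c0) A (x0 + y))].
   A continuous competitor cannot leave the ball in which fixed points are
   unique, by the intermediate value theorem applied to its distance to [x0]. *)
Lemma quadratic_branch (e1 : R) : 0 < e1 ->
  exists (e : R) (x dx : R -> V), [/\ 0 < e <= e1, x c0 = x0,
    forall c, `|c - c0| < e -> [/\ quadratic_eq c (x c) = 0,
      h^-1 *: (x (c + h) - x c) @[h --> 0^'] --> dx c &
      {for c, continuous dx}] &
    forall z : R -> V, z c0 = x0 ->
      (forall c, `|c - c0| < e ->
         quadratic_eq c (z c) = 0 /\ {for c, continuous z}) ->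
      forall c, `|c - c0| < e -> z c = x c].
Proof.
move=> e10.
(* The constants [r] and [e] make [s b r], [s a e] and [M1 e / r] at most [1/8]. Then [S] composed
   with [F] has norm at most [3/8], hence at most [1/2], on the ball. Adding [1] to [a], [b] and
   [M1] keeps the denominators positive. *)
pose r := (8 * s * (b + 1))^-1.
have b1 : 0 < b + 1 by rewrite ltr_wpDl.
have a1 : 0 < a + 1 by rewrite ltr_wpDl.
have r0 : 0 < r by rewrite invr_gt0 !mulr_gt0.
have sbr : s * b * r <= 8^-1.
  have : s * (b + 1) * r = 8^-1 by rewrite /r; field; rewrite !gt_eqF.
  have : 0 <= s * r by rewrite mulr_ge0// ltW.
  by lra.
pose M1 := s * a * (`|x0| + r).
have M10 : 0 <= M1 by rewrite mulr_ge0 ?addr_ge0// ?mulr_ge0// ltW.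
pose e := Order.min e1 (Order.min (8 * s * (a + 1))^-1 (r / (8 * (M1 + 1)))).
have e0 : 0 < e.
  by rewrite !lt_min e10 invr_gt0 divr_gt0// !mulr_gt0//; lra.
have sea : s * a * e <= 8^-1.
  have : s * (a + 1) * e <= 8^-1.
    have h : e <= (8 * s * (a + 1))^-1 by rewrite /e !ge_min lexx orbT.
    have sa1 : 0 < s * (a + 1) by rewrite mulr_gt0.
    rewrite (le_trans (ler_wpM2l (ltW sa1) h))//.
    by rewrite le_eqVlt; apply/orP; left; apply/eqP; field; rewrite !gt_eqF.
  have : 0 <= s * e by rewrite mulr_ge0// ltW.
  by lra.
have eM1 : M1 * e <= r / 8.
  have : (M1 + 1) * e <= r / 8.
    have h : e <= r / (8 * (M1 + 1)) by rewrite /e !ge_min lexx !orbT.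
    have M11 : 0 < M1 + 1 by lra.
    rewrite (le_trans (ler_wpM2l (ltW M11) h))//.
    by rewrite le_eqVlt; apply/orP; left; apply/eqP; field; rewrite gt_eqF.
  by lra.
have half (u t : R) : u <= 2^-1 * u + t -> u <= 2 * t by lra.
have halfF d y y' w : `|d| <= e -> `|y| <= r -> `|y'| <= r ->
    `|S (F d y y' w)| <= 2^-1 * `|w|.
  move=> de yr yr'; rewrite (le_trans (SF _ _ _ _))// ler_wpM2r//.
  have sb0 : 0 <= s * b by rewrite mulr_ge0// ltW.
  have sa0 : 0 <= s * a by rewrite mulr_ge0// ltW.
  have := ler_wpM2l sb0 yr; have := ler_wpM2l sb0 yr'.
  have := ler_wpM2l sa0 de; lra.
have arg_diff_same d u u' : arg d u - arg d u' = F d u u' (u - u').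
  by rewrite arg_diff subrr scale0r subr0.
have sAbnd u : `|u| <= r -> s * `|A (x0 + u)| <= M1.
  move=> ur; rewrite /M1 -mulrA ler_pM2l// (le_trans (Aa _))// ler_wpM2l//.
  by rewrite (le_trans (ler_normD _ _))// lerD2l.
(* Landing in the half ball, and not merely in the ball, leaves a gap between [r / 2] and [r] that
   no solution can occupy. *)
have arg_r d u : `|d| <= e -> `|u| <= r -> `|S (arg d u)| <= r / 2.
  move=> de ur; rewrite (le_trans (Ss _))//.
  have h1 : s * `|d *: A (x0 + u)| <= r / 8.
    by rewrite normrZ mulrCA (le_trans _ eM1)// mulrC ler_pM// ?sAbnd// mulr_ge0// ltW.
  have h2 : s * `|B u u| <= r / 8.
    rewrite (@le_trans _ _ (s * (b * r * r)))//.
      by rewrite ler_pM2l// (le_trans (Bb _ _))// ler_pM// ?mulr_ge0// ler_wpM2l.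
    by rewrite !mulrA mulrC ler_wpM2l// ltW.
  have := ler_wpM2l (ltW s0) (ler_normB (B u u) (d *: A (x0 + u))).
  by rewrite -/(arg d u); lra.
have ex c : exists y, `|c - c0| <= e -> `|y| <= r /\ S (arg (c - c0) y) = y.
  have [ce|] := boolP (`|c - c0| <= e); last by exists 0.
  have [||||y yr yE] := @ball_fixed_point _ V (fun y => S (arg (c - c0) y)) 2^-1 r.
  - by lra.
  - exact: ltW.
  - by move=> u ur; rewrite (le_trans (arg_r _ _ ce ur))//; lra.
  - by move=> u v ur vr; rewrite -(linB Sl) arg_diff_same halfF.
  by exists y.
have {ex} [y yP] := choice ex.
have yr c : `|c - c0| <= e -> `|y c| <= r by move=> /yP[].
have yS c : `|c - c0| <= e -> S (arg (c - c0) (y c)) = y c by move=> /yP[].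
have y_uniq c u : `|c - c0| <= e -> `|u| <= r -> S (arg (c - c0) u) = u -> u = y c.
  move=> ce ur uE; apply/subr0_eq/normr0_eq0/le_anti; rewrite normr_ge0 andbT.
  have := halfF _ _ _ (u - y c) ce ur (yr _ ce).
  by rewrite -arg_diff_same (linB Sl) uE yS//; lra.
have ydiff c c' : `|c - c0| <= e -> `|c' - c0| <= e -> y c - y c' =
    S (F (c - c0) (y c) (y c') (y c - y c')) - (c - c') *: S (A (x0 + y c')).
  move=> ce c'e; rewrite -{1}(yS c)// -{1}(yS c')// -(linB Sl) arg_diff (linB Sl).
  by rewrite (linZ Sl) opprB addrA subrK.
have ylip c c' : `|c - c0| <= e -> `|c' - c0| <= e ->
    `|y c - y c'| <= 2 * M1 * `|c - c'|.
  move=> ce c'e; rewrite -mulrA; apply: half; rewrite {1}ydiff//.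
  rewrite (le_trans (ler_normB _ _))// lerD// ?halfF ?yr//.
  by rewrite normrZ mulrC ler_wpM2r// (le_trans (Ss _))// sAbnd// yr.
(* The derivative [z] is defined by formally differentiating [y = S (arg (c - c0) y)] in [c]. The
   resulting linear equation is solvable by a Neumann series with ratio [1/2]. *)
have ez c : exists z, `|c - c0| <= e ->
    z - S (F (c - c0) (y c) (y c) z) = - S (A (x0 + y c)) /\ `|z| <= 2 * M1.
  have [ce|] := boolP (`|c - c0| <= e); last by exists 0.
  pose N w := - S (F (c - c0) (y c) (y c) w).
  have Nl : linear N.
    by move=> k u v; rewrite /N Fl Sl opprD scalerN.
  have [||_ [T [_ TE Tb]]] := @neumann _ V N 2^-1 Nl.
  - by lra.
  - by move=> w; rewrite normrN halfF// yr.
  exists (T (- S (A (x0 + y c)))) => _; split; first exact: TE.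
  rewrite (le_trans (Tb _))// normrN -[X in X * _]/(1 - 2^-1)^-1.
  have -> : (1 - 2^-1)^-1 = 2 :> R by field.
  by rewrite ler_pM2l// (le_trans (Ss _))// sAbnd// yr.
have {ez} [z zP] := choice ez.
have zr c : `|c - c0| <= e -> `|z c| <= 2 * M1 by move=> /zP[].
have zE c : `|c - c0| <= e ->
    z c = S (F (c - c0) (y c) (y c) (z c)) - S (A (x0 + y c)).
  by move=> /zP[<- _]; rewrite addrC subrK.
have F0 d u u' v : `|u| <= 2 * M1 * `|d| -> `|u'| <= 2 * M1 * `|d| ->
    `|v| <= 2 * M1 ->
    `|S (F d u u' v)| <= s * (4 * b * M1 + a) * (2 * M1) * `|d|.
  move=> ud u'd vM; rewrite (le_trans (SF _ _ _ _))// [leRHS]mulrAC.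
  apply: ler_pM => //.
    by rewrite mulr_ge0 ?addr_ge0 ?mulr_ge0// ltW.
  rewrite -[leRHS]mulrA ler_pM2l// mulrDl lerD2r.
  by have := ler_wpM2l b0 ud; have := ler_wpM2l b0 u'd; lra.
pose K := s * (4 * b * M1 + a) * (2 * M1).
have K0 : 0 <= K.
  have bM1 : 0 <= b * M1 by rewrite mulr_ge0.
  apply: mulr_ge0; last by rewrite mulr_ge0.
  apply: mulr_ge0; first exact: ltW.
  by rewrite addr_ge0// -mulrA mulr_ge0.
have Keps (k t eps : R) : 0 <= k -> 0 <= t < eps / (2 * (k + 1)) ->
    2 * (k * t) <= eps.
  move=> k0 /andP[t0]; rewrite ltr_pdivlMr; last lra.
  by lra.
have Keps0 (k eps : R) : 0 <= k -> 0 < eps -> 0 < eps / (2 * (k + 1)).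
  by move=> k0 eps0; rewrite divr_gt0// mulr_gt0//; lra.
have near_e c : `|c - c0| < e -> \forall c' \near c, `|c' - c0| <= e.
  move=> ce; near=> c'; rewrite ltW//.
  rewrite (le_lt_trans (ler_distD c _ _))// -ltrBrDr distrC.
  by near: c'; apply: cvgr_dist_lt; rewrite ?subr_gt0//; exact: cvg_id.
exists e, (fun c => x0 + y c), z; split.
- by rewrite e0 /e ge_min lexx.
- rewrite -(y_uniq c0 0) ?addr0 ?subrr ?normr0 ?ltW//.
  by rewrite /arg scale0r subr0 (lin0 (Bl 0)) (lin0 Sl).
- move=> c ce; have ce' := ltW ce; split.
  + exact/quadratic_fixP/yS.
  + apply/cvgrPdist_le => eps eps0.
    near=> h.
    have h0 : h != 0 by near: h; exact: nbhs_dnbhs_neq.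
    have che : `|c + h - c0| <= e.
      rewrite addrAC (le_trans (ler_normD _ _))// -lerBrDl ltW//.
      by near: h; apply: dnbhs0_lt; rewrite subr_gt0.
    set q := h^-1 *: _.
    (* The difference quotient solves the equation of [z c] with slightly displaced coefficients. In
       [q - z c] the part [S (F ... (q - z c))] is absorbed with factor [1/2], and the displacement
       is [O(|h|)] by the Lipschitz bound on [y]. *)
    have qE : q = S (F (c + h - c0) (y (c + h)) (y c) q) - S (A (x0 + y c)).
      have dE : x0 + y (c + h) - (x0 + y c) = y (c + h) - y c.
        by rewrite opprD addrACA subrr add0r.
      have hE : c + h - c = h by rewrite addrAC subrr add0r.
      rewrite {1}/q dE {1}ydiff// hE scalerBr scalerA mulVf// scale1r.
      by rewrite -(linZ Sl) -(linZ (Fl _ _ _)) /q dE.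
    have : `|q - z c| <= 2 * (K * `|h|).
      apply: half; rewrite {1}qE {1}zE// opprB addrA subrK -(linB Sl).
      rewrite -[X in S (X - _)](subrK (F (c + h - c0) (y (c + h)) (y c) (z c))).
      rewrite -(linB (Fl _ _ _)) -addrA F_diff (linD Sl).
      rewrite (le_trans (ler_normD _ _))// lerD ?halfF ?yr//.
      have hE : c + h - c0 - (c - c0) = h by ring.
      rewrite hE; apply: F0 => //; last exact: zr.
        by rewrite (le_trans (ylip _ _ _ _))//; have -> : c + h - c = h by ring.
      by rewrite subrr normr0 mulr_ge0// mulr_ge0.
    rewrite distrC => /le_trans; apply; apply: Keps => //.
    rewrite normr_ge0/=; near: h; apply: dnbhs0_lt.
    exact: Keps0.
  + apply/cvgrPdist_le => eps eps0.
    pose K2 := K + s * a * (2 * M1).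
    have K20 : 0 <= K2.
      apply: addr_ge0 => //; apply: mulr_ge0; last exact: mulr_ge0.
      by apply: mulr_ge0 => //; exact: ltW.
    near=> c'.
    have c'e : `|c' - c0| <= e by near: c'; exact: near_e.
    (* The same absorption shows that the derivative is Lipschitz; the extra term of [K2] comes from
       the right-hand side [S (A (x0 + y c))]. *)
    have : `|z c - z c'| <= 2 * (K2 * `|c - c'|).
      have zd : z c - z c' = S (F (c - c0) (y c) (y c) (z c)) -
          S (F (c' - c0) (y c') (y c') (z c')) - S (A (y c - y c')).
        have -> : S (A (y c - y c')) = S (A (x0 + y c)) - S (A (x0 + y c')).
          by rewrite -(linB Sl) -(linB Al) opprD addrACA subrr add0r.
        by rewrite {1}zE// [in LHS](zE c')// [in LHS]opprD addrACA -opprD.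
      apply: half; rewrite {1}zd -(linB Sl).
      rewrite -[X in S (X - _)](subrK (F (c - c0) (y c) (y c) (z c'))).
      rewrite -(linB (Fl _ _ _)) -addrA F_diff (linD Sl).
      have -> : c - c0 - (c' - c0) = c - c' by rewrite opprB addrA subrK.
      rewrite -addrA (le_trans (ler_normD _ _))// lerD ?halfF ?yr//.
      rewrite /K2 mulrDl (le_trans (ler_normB _ _))// lerD//.
        by apply: F0; rewrite ?ylip ?zr.
      rewrite -!mulrA (le_trans (Ss _))// ler_pM2l// (le_trans (Aa _))// ler_wpM2l//.
      by rewrite (le_trans (ylip _ _ _ _))// /M1 -!mulrA.
    move=> /le_trans; apply; apply: Keps => //.
    rewrite normr_ge0/=; near: c'; apply: cvgr_dist_lt; first exact: cvg_id.
    exact: Keps0.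
- move=> w wc0 wP c ce.
  pose phi c := `|w c - x0|.
  have gap c' : `|c' - c0| < e -> phi c' <= r -> phi c' <= r / 2 /\ w c' = x0 + y c'.
    move=> c'e wr; have [wG _] := wP _ c'e.
    have wE : w c' = x0 + (w c' - x0) by rewrite addrC subrK.
    have /quadratic_fixP wS : quadratic_eq c' (x0 + (w c' - x0)) = 0.
      by rewrite -wE.
    split; first by rewrite /phi -wS arg_r// ltW.
    by rewrite {1}wE (y_uniq _ _ (ltW c'e) wr).
  suff : phi c <= r by case/(gap _ ce).
  rewrite leNgt; apply/negP => phir.
  have phi0 : phi c0 = 0 by rewrite /phi wc0 subrr normr0.
  have c0e : `|c0 - c0| < e by rewrite subrr normr0.
  (* The value [3 r / 4] lies in the forbidden gap, while a competitor leaving the ball would have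
     to attain it between [c0] and [c]. The minimum and maximum cover both orders of these two
     points. *)
  have ivt p q : p <= q -> `|p - c0| < e -> `|q - c0| < e ->
      Order.min (phi p) (phi q) <= 3 / 4 * r <= Order.max (phi p) (phi q) ->
      False.
    move=> pq pe qe /(IVT pq)[|t].
      apply: continuous_in_subspaceT => t; rewrite inE/= in_itv/= => /andP[pt tq].
      have te : `|t - c0| < e.
        by move: pe qe; rewrite !ltr_norml; lra.
      have [_ wt] := wP _ te.
      by apply: cvg_norm; apply: cvgB => //; exact: cvg_cst.
    rewrite in_itv/= => /andP[pt tq] phit.
    have te : `|t - c0| < e by move: pe qe; rewrite !ltr_norml; lra.
    have [|+ _] := gap t te; first by rewrite phit; lra.
    by rewrite phit; lra.
  have [cc0|cc0] := leP c c0.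
    apply: (ivt c c0) => //; rewrite phi0 ge_min le_max.
    by apply/andP; split; apply/orP; [right|left]; lra.
  apply: (ivt c0 c (ltW cc0)) => //; rewrite phi0 ge_min le_max.
  by apply/andP; split; apply/orP; [left|right]; lra.
Unshelve. all: end_near. Qed.

End QuadraticEquation.

Lemma cvg_sum_ord {R : realType} {T : Type} (F : set_system T) {FF : Filter F} n
    (f : nat -> T -> R) (l : nat -> R) :
  (forall k, f k @ F --> l k) ->
  (fun t => \sum_(k < n) f k t) @ F --> \sum_(k < n) l k.
Proof.
move=> fl; elim: n => [|n IH].
  by rewrite big_ord0; under eq_fun do rewrite big_ord0; exact: cvg_cst.
by rewrite big_ord_recr; under eq_fun do rewrite big_ord_recr/=; exact: cvgD.
Qed.

(** * The sequence space l^2 and weighted convolutions *)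

Section SquareSummable.
Context {R : realType}.
Implicit Types x y : nat -> R.

Lemma cauchy_schwarz_sum x y n : (\sum_(k < n) x k * y k) ^+ 2 <=
  (\sum_(k < n) x k ^+ 2) * (\sum_(k < n) y k ^+ 2).
Proof.
elim: n => [|n IH]; first by rewrite !big_ord0 mul0r expr0n.
rewrite !big_ord_recr/=; move: IH.
have : 0 <= \sum_(i < n) x i ^+ 2 by rewrite sumr_ge0// => i _; exact: sqr_ge0.
have : 0 <= \sum_(i < n) y i ^+ 2 by rewrite sumr_ge0// => i _; exact: sqr_ge0.
move: (\sum_(i < n) x i * y i) (\sum_(i < n) x i ^+ 2) (\sum_(i < n) y i ^+ 2).
move: (x n) (y n) => {x y} p q C A B B0 A0 CAB.
(* Compare squares: [4 C^2 p^2 q^2 <= 4 A B p^2 q^2 <= (A q^2 + B p^2)^2]. *)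
have h : 2 * C * (p * q) <= A * q ^+ 2 + B * p ^+ 2.
  rewrite (le_trans (ler_norm _))// -ler_sqr ?nnegrE//; last first.
    by rewrite addr_ge0// mulr_ge0// sqr_ge0.
  rewrite real_normK ?num_real//.
  apply: (@le_trans _ _ (4 * (A * B) * (p * q) ^+ 2)).
    have := ler_wpM2r (sqr_ge0 (p * q)) CAB; lra.
  have := sqr_ge0 (A * q ^+ 2 - B * p ^+ 2); lra.
by lra.
Qed.

Definition square_summable x :=
  exists M : R, forall n, \sum_(k < n) x k ^+ 2 <= M.

Definition l2norm x := Num.sqrt (sup (range (fun n => \sum_(k < n) x k ^+ 2))).

Lemma l2norm_ge0 x : 0 <= l2norm x. Proof. exact: sqrtr_ge0. Qed.

Lemma l2norm_le x (M : R) : 0 <= M ->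
  (forall n, \sum_(k < n) x k ^+ 2 <= M ^+ 2) -> l2norm x <= M.
Proof.
move=> M0 h; rewrite -[leRHS]ger0_norm// -sqrtr_sqr ler_wsqrtr//.
by apply: ge_sup; [exists 0; exists 0; rewrite ?big_ord0|move=> _ [n _ <-]].
Qed.

Lemma sum_le_l2norm x n : square_summable x ->
  \sum_(k < n) x k ^+ 2 <= l2norm x ^+ 2.
Proof.
move=> [M xM]; have xS : has_ubound (range (fun n => \sum_(k < n) x k ^+ 2)).
  by exists M => _ [m _ <-].
rewrite sqr_sqrtr; first by apply: ub_le_sup => //; exists n.
by apply: ub_le_sup => //; exists 0; rewrite ?big_ord0.
Qed.

Lemma sum_l2D x y n : square_summable x -> square_summable y ->
  \sum_(k < n) (x k + y k) ^+ 2 <= (l2norm x + l2norm y) ^+ 2.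
Proof.
move=> xs ys.
have -> : \sum_(k < n) (x k + y k) ^+ 2 = \sum_(k < n) x k ^+ 2 +
    2 * (\sum_(k < n) x k * y k) + \sum_(k < n) y k ^+ 2.
  by rewrite mulr_sumr -!big_split/=; apply: eq_bigr => k _; ring.
have hx := sum_le_l2norm n xs; have hy := sum_le_l2norm n ys.
have x0 := l2norm_ge0 x; have y0 := l2norm_ge0 y.
suff : \sum_(k < n) x k * y k <= l2norm x * l2norm y by lra.
rewrite (le_trans (ler_norm _))// -ler_sqr ?nnegrE ?mulr_ge0//.
rewrite real_normK ?num_real// (le_trans (cauchy_schwarz_sum _ _ _))// exprMn.
by rewrite ler_pM// sumr_ge0// => i _; exact: sqr_ge0.
Qed.

Definition l2_pred : {pred (nat -> R)} := fun x => `[< square_summable x >].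

Lemma l2_submod : submod_closed l2_pred.
Proof.
split; first by apply/asboolP; exists 0 => n; rewrite big1// => k _; rewrite expr0n.
move=> a x y /asboolP[M xM] /asboolP ys; apply/asboolP.
have axs : square_summable (a *: x).
  exists (a ^+ 2 * M) => n; rewrite (eq_bigr (fun k : 'I_n => a ^+ 2 * x k ^+ 2)).
    by rewrite -mulr_sumr ler_wpM2l ?sqr_ge0 ?xM.
  by move=> k _; rewrite -exprMn.
by exists ((l2norm (a *: x) + l2norm y) ^+ 2) => n; exact: sum_l2D.
Qed.

HB.instance Definition _ := GRing.isSubmodClosed.Build R (nat -> R) l2_pred l2_submod.

Record l2 := L2 {l2val :> nat -> R; _ : l2val \in l2_pred}.

HB.instance Definition _ := [isSub for l2val].
HB.instance Definition _ := [Choice of l2 by <:].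
HB.instance Definition _ := [SubChoice_isSubLmodule of l2 by <:].

Lemma l2P (x : l2) : square_summable x. Proof. by case: x => x /= /asboolP. Qed.

Definition mkl2 x (xs : square_summable x) : l2 := L2 (asboolT xs).

Lemma l2_ext (x y : l2) : (forall k, x k = y k) -> x = y.
Proof. by move=> xy; apply/val_inj/funext. Qed.

Lemma l2DE (x y : l2) k : (x + y) k = x k + y k. Proof. by []. Qed.
Lemma l2BE (x y : l2) k : (x - y) k = x k - y k. Proof. by []. Qed.
Lemma l2ZE a (x : l2) k : (a *: x) k = a * x k. Proof. by []. Qed.
Lemma l2_0E k : (0 : l2) k = 0. Proof. by []. Qed.

Let normD (x y : l2) : l2norm (x + y) <= l2norm x + l2norm y.
Proof.
by apply: l2norm_le => [|n]; [rewrite addr_ge0 ?l2norm_ge0|apply: sum_l2D; exact: l2P].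
Qed.

Let normZ_le a (x : l2) : l2norm (a *: x) <= `|a| * l2norm x.
Proof.
apply: l2norm_le => [|n]; first by rewrite mulr_ge0// l2norm_ge0.
rewrite exprMn real_normK ?num_real//.
rewrite (eq_bigr (fun k : 'I_n => a ^+ 2 * x k ^+ 2)).
  by rewrite -mulr_sumr ler_wpM2l ?sqr_ge0// sum_le_l2norm//; exact: l2P.
by move=> k _; rewrite -exprMn.
Qed.

Let norm0_eq0 (x : l2) : l2norm x = 0 -> x = 0.
Proof.
move=> x0; apply: l2_ext => k; apply/eqP; rewrite -sqrf_eq0.
have := sum_le_l2norm k.+1 (l2P x); rewrite x0 expr0n/= big_ord_recr/=.
have := sqr_ge0 (x k).
have : 0 <= \sum_(i < k) x i ^+ 2 by rewrite sumr_ge0// => i _; exact: sqr_ge0.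
by move=> h1 h2 h3; rewrite eq_le; apply/andP; split; lra.
Qed.

Let normZ a (x : l2) : l2norm (a *: x) = `|a| * l2norm x.
Proof.
apply/le_anti; rewrite normZ_le/=.
have [->|a0] := eqVneq a 0; first by rewrite normr0 mul0r l2norm_ge0.
rewrite -ler_pdivlMl ?normr_gt0// -normfV.
by have := normZ_le a^-1 (a *: x); rewrite scalerA mulVf// scale1r.
Qed.

HB.instance Definition _ :=
  Lmodule_isNormed.Build R l2 normD normZ norm0_eq0.

Lemma l2_norm_le (x : l2) (M : R) : 0 <= M ->
  (forall n, \sum_(k < n) x k ^+ 2 <= M ^+ 2) -> `|x| <= M.
Proof. exact: l2norm_le. Qed.

Lemma l2_sum_le (x : l2) n : \sum_(k < n) x k ^+ 2 <= `|x| ^+ 2.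
Proof. exact/sum_le_l2norm/l2P. Qed.

Lemma l2_coord_le (x : l2) k : `|x k| <= `|x|.
Proof.
rewrite -ler_sqr ?nnegrE// real_normK ?num_real// (le_trans _ (l2_sum_le x k.+1))//.
by rewrite big_ord_recr/= lerDr sumr_ge0// => i _; exact: sqr_ge0.
Qed.

(** The limit is taken coordinatewise. The Cauchy bound concerns finite partial sums, so it passes
    to the limit for each length separately, with a constant that does not depend on the length. *)
Lemma l2_complete (F : set_system l2) : ProperFilter F -> cauchy F -> cvg F.
Proof.
move=> FF /cauchy_ballP Fc; apply/cvg_ex.
have ballE (x y : l2) e : ball x e y = (`|x - y| < e) by rewrite -ball_normE.
have coord k : cvg ((fun x : l2 => x k) @ F).
  apply: R_complete; apply/cauchy_ballP => e e0.
  have [[P Q] [FP FQ] PQ] := Fc _ e0.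
  exists ((fun x : l2 => x k) @` P, (fun x : l2 => x k) @` Q).
    by split; [apply: filterS FP | apply: filterS FQ] => x Px; exists x.
  move=> _ [] /= [x Px <-] [y Qy <-]; rewrite -ball_normE/=.
  have := PQ (x, y) (conj Px Qy); rewrite /= ballE; apply: le_lt_trans.
  exact: (l2_coord_le (x - y)).
pose l k := lim ((fun x : l2 => x k) @ F).
have key (e : R) : 0 < e -> \forall x \near F,
    forall n, \sum_(k < n) (l k - (x : l2) k) ^+ 2 <= e ^+ 2.
  move=> e0.
  have /nearP_dep := Fc _ e0.
  apply: filterS => x xF n.
  have lc : (fun y : l2 => \sum_(k < n) (y k - x k) ^+ 2) @ F -->
      \sum_(k < n) (l k - x k) ^+ 2.
    apply: (@cvg_sum_ord _ _ _ _ _ (fun k (y : l2) => (y k - x k) ^+ 2)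
      (fun k => (l k - x k) ^+ 2)) => k.
    have ylk : (fun y : l2 => y k - x k) @ F --> l k - x k.
      by apply: cvgB; [exact: coord|exact: cvg_cst].
    by rewrite expr2; under eq_fun do rewrite expr2; exact: cvgM.
  apply: (cvgr_to_le lc); apply: filterS xF => y; rewrite ballE => xy.
  have := l2_sum_le (y - x) n; rewrite distrC => /le_trans; apply.
  by rewrite ler_sqr ?nnegrE// ltW.
have ls : square_summable l.
  have [x xl] := filter_ex (key 1 ltr01).
  have zs : square_summable (fun k => l k - x k) by exists (1 ^+ 2) => n; exact: xl.
  exists ((l2norm (fun k => l k - x k) + l2norm x) ^+ 2) => n.
  apply: le_trans (sum_l2D n zs (l2P x)); rewrite le_eqVlt; apply/orP; left.
  by apply/eqP/eq_bigr => k _; rewrite subrK.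
exists (mkl2 ls); apply/cvgrPdist_le => e e0; near=> x.
apply: l2_norm_le => [|n]; first exact: ltW.
by move: n; near: x; exact: key.
Unshelve. all: end_near. Qed.

HB.instance Definition _ := Uniform_isComplete.Build l2 l2_complete.

End SquareSummable.
Arguments l2 R : clear implicits.

(** * Convolutions of weighted cosine coefficients *)

Section Convolution.
Context {R : realType}.
Implicit Types (g a b u v : nat -> R) (x y : l2 R).

Lemma sum_uniq_le g (M : R) (s : seq nat) : (forall k, 0 <= g k) ->
  (forall n, \sum_(k < n) g k <= M) -> uniq s -> \sum_(k <- s) g k <= M.
Proof.
move=> g0 gM us; pose N := (\max_(k <- s) k).+1.
have sN : perm_eq s [seq k <- iota 0 N | k \in s].
  apply: uniq_perm => // [|k]; first by rewrite filter_uniq// iota_uniq.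
  rewrite mem_filter mem_iota/= add0n; case: (boolP (k \in s)) => //= ks.
  by rewrite ltnS leq_bigmax_seq.
rewrite (perm_big _ sN) big_filter (le_trans _ (gM N))//.
rewrite -(big_mkord xpredT g) /index_iota subn0 big_mkcond/=.
by apply: ler_sum => k _; case: ifP.
Qed.

Lemma sum_comp_le g (M : R) (phi : nat -> nat) (P : pred nat) n :
  (forall k, 0 <= g k) -> (forall n, \sum_(k < n) g k <= M) ->
  {in P &, injective phi} -> \sum_(k < n | P k) g (phi k) <= M.
Proof.
move=> g0 gM phiI.
have -> : \sum_(k < n | P k) g (phi k) =
    \sum_(k <- [seq phi k | k <- iota 0 n & P k]) g k.
  rewrite big_map big_filter -(big_mkord P (g \o phi)) /index_iota subn0//.
apply: sum_uniq_le => //; rewrite map_inj_in_uniq ?filter_uniq ?iota_uniq//.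
by move=> i j; rewrite !mem_filter => /andP[Pi _] /andP[Pj _]; exact: phiI.
Qed.

Definition absdiff (k m : nat) := ((k - m) + (m - k))%N.

Lemma absdiffC k m : absdiff k m = absdiff m k.
Proof. by rewrite /absdiff addnC. Qed.

Lemma sum_add_le g (M : R) m n : (forall k, 0 <= g k) ->
  (forall n, \sum_(k < n) g k <= M) -> \sum_(k < n) g (k + m)%N <= 2 * M.
Proof.
move=> g0 gM; have M0 : 0 <= M by have := gM 0; rewrite big_ord0.
rewrite (@le_trans _ _ M)//; last by lra.
by apply: (@sum_comp_le g M (addn^~ m) xpredT) => // i j _ _ /addIn.
Qed.

Lemma sum_absdiff_le g (M : R) m n : (forall k, 0 <= g k) ->
  (forall n, \sum_(k < n) g k <= M) -> \sum_(k < n) g (absdiff k m) <= 2 * M.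
Proof.
move=> g0 gM; rewrite (bigID (fun k : 'I_n => (k < m)%N))/= mulr_natl mulr2n lerD//.
  apply: (@sum_comp_le g M (absdiff^~ m) (fun k => k < m)%N) => // i j.
  rewrite /absdiff => im jm.
  by have {im}: (i < m)%N := im; have {jm}: (j < m)%N := jm; lia.
apply: (@sum_comp_le g M (absdiff^~ m) (fun k => ~~ (k < m))%N) => // i j.
rewrite /absdiff => im jm.
by have {im}: ~~ (i < m)%N := im; have {jm}: ~~ (j < m)%N := jm; lia.
Qed.

(** The two index maps produced by a product of cosines are [k + m] and [|k - m|]. With one argument
    fixed, each takes a given value at most twice, and this is all the convolution estimates require
    of them. *)
Definition pairing_bound (phi : nat -> nat -> nat) :=
  forall g (M : R), (forall k, 0 <= g k) -> (forall n, \sum_(k < n) g k <= M) ->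
  forall m n, \sum_(k < n) g (phi k m) <= 2 * M /\
              \sum_(k < n) g (phi m k) <= 2 * M.

Lemma pairing_add : pairing_bound addn.
Proof.
move=> g M g0 gM m n; split; first exact: sum_add_le.
by under eq_bigr do rewrite addnC; exact: sum_add_le.
Qed.

Lemma pairing_absdiff : pairing_bound absdiff.
Proof.
move=> g M g0 gM m n; split; first exact: sum_absdiff_le.
by under eq_bigr do rewrite absdiffC; exact: sum_absdiff_le.
Qed.

Section Pairing.
Variable phi : nat -> nat -> nat.
Hypothesis phiP : pairing_bound phi.

Definition pair_sum a b m n := \sum_(k < n) a k * b (phi k m).

Variables (u v : nat -> R) (U V : R).
Hypotheses (U0 : 0 <= U) (V0 : 0 <= V).
Hypotheses (uU : forall n, \sum_(k < n) u k ^+ 4 <= U ^+ 4)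
           (vV : forall n, \sum_(k < n) v k ^+ 4 <= V ^+ 4).

(* [u^2 v^2] is summable along [phi] by Cauchy-Schwarz once [u^4] and [v^4] are:
   for [u = v = m^-alpha] this is where [alpha > 1/4] is used. *)
Lemma weights_pair_le m n :
  \sum_(k < n) u k ^+ 2 * v (phi k m) ^+ 2 <= 2 * (U * V) ^+ 2.
Proof.
have v40 k : 0 <= v k ^+ 4 by rewrite (exprM _ 2 2) sqr_ge0.
have [h _] := phiP v40 vV m n.
have h0 : 0 <= (U * V) ^+ 2 by rewrite sqr_ge0.
rewrite (le_trans (ler_norm _))// -ler_sqr ?nnegrE ?mulr_ge0//.
rewrite real_normK ?num_real//.
rewrite (le_trans (cauchy_schwarz_sum (fun k => u k ^+ 2)
  (fun k => v (phi k m) ^+ 2) n))//.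
under eq_bigr do rewrite -exprM; under [X in _ * X]eq_bigr do rewrite -exprM.
have s0 w (f : nat -> nat) : 0 <= \sum_(k < n) w (f k) ^+ 4 :> R.
  by rewrite sumr_ge0// => k _; rewrite (exprM _ 2 2) sqr_ge0.
rewrite (le_trans (ler_pM (s0 u id) (s0 v (phi^~ m)) (uU n) h))//.
have := sqr_ge0 ((U * V) ^+ 2); rewrite !exprMn; lra.
Qed.

Variables x y : l2 R.
Let a k := u k * x k.
Let b k := v k * y k.

Lemma pair_sum_sqr_le m n : pair_sum a b m n ^+ 2 <=
  2 * (U * V) ^+ 2 * \sum_(k < n) x k ^+ 2 * y (phi k m) ^+ 2.
Proof.
have -> : pair_sum a b m n =
    \sum_(k < n) (u k * v (phi k m)) * (x k * y (phi k m)).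
  by apply: eq_bigr => k _; rewrite /a /b mulrACA.
rewrite (le_trans (cauchy_schwarz_sum (fun k => u k * v (phi k m))
  (fun k => x k * y (phi k m)) n))//.
under eq_bigr do rewrite exprMn; under [X in _ * X]eq_bigr do rewrite exprMn.
by rewrite ler_wpM2r ?weights_pair_le// sumr_ge0// => k _; rewrite mulr_ge0// sqr_ge0.
Qed.

(** Cauchy-Schwarz separates the weights, bounded uniformly in [m], from [x_k^2 y_(phi k m)^2]. In
    the latter the sum over [m] is done first, for fixed [k], and costs [2 |y|^2]. *)
Lemma sum_pair_sum_le n N : \sum_(m < N) pair_sum a b m n ^+ 2 <=
  (2 * U * V * `|x| * `|y|) ^+ 2.
Proof.
rewrite (@le_trans _ _ (\sum_(m < N) 2 * (U * V) ^+ 2 *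
    \sum_(k < n) x k ^+ 2 * y (phi k m) ^+ 2))//.
  by apply: ler_sum => m _; exact: pair_sum_sqr_le.
rewrite -mulr_sumr exchange_big/=.
have -> : (2 * U * V * `|x| * `|y|) ^+ 2 =
  2 * (U * V) ^+ 2 * (`|x| ^+ 2 * (2 * `|y| ^+ 2)) by ring.
rewrite ler_wpM2l ?mulr_ge0 ?sqr_ge0//.
rewrite (@le_trans _ _ (\sum_(k < n) x k ^+ 2 * (2 * `|y| ^+ 2)))//.
  apply: ler_sum => k _; rewrite -mulr_sumr ler_wpM2l ?sqr_ge0//.
  by have [_] := phiP (fun j => sqr_ge0 (y j)) (l2_sum_le y) k N.
by rewrite -mulr_suml ler_wpM2r ?mulr_ge0 ?sqr_ge0// l2_sum_le.
Qed.

Lemma pair_sum_bound m n : `|pair_sum a b m n| <= 2 * U * V * `|x| * `|y|.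
Proof.
rewrite -ler_sqr ?nnegrE// ?mulr_ge0// real_normK ?num_real//.
rewrite (le_trans _ (sum_pair_sum_le n m.+1))// big_ord_recr/= lerDr.
by rewrite sumr_ge0// => i _; exact: sqr_ge0.
Qed.

End Pairing.

Definition l2_abs x : l2 R.
Proof.
apply: (@mkl2 _ (fun k => `|x k|)); exists (`|x| ^+ 2) => n.
by rewrite (le_trans _ (l2_sum_le x n))// ler_sum// => k _; rewrite real_normK ?num_real.
Defined.

(** Absolute convergence: the finite bound is applied to the absolute values of both weights and
    both sequences, which have the same norms and fourth-power sums. *)
Lemma pair_sum_cvg phi u v U V x y m : pairing_bound phi -> 0 <= U -> 0 <= V ->
  (forall n, \sum_(k < n) u k ^+ 4 <= U ^+ 4) ->
  (forall n, \sum_(k < n) v k ^+ 4 <= V ^+ 4) ->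
  cvgn (pair_sum phi (fun k => u k * x k) (fun k => v k * y k) m).
Proof.
move=> phiP U0 V0 uU vV.
pose t k := (u k * x k) * (v (phi k m) * y (phi k m)).
have -> : pair_sum phi (fun k => u k * x k) (fun k => v k * y k) m = series t.
  by apply/funext => n; rewrite /pair_sum /series/= big_mkord.
apply: normed_cvg; apply: nondecreasing_is_cvgn.
  by apply: nondecreasing_series => k _ _; exact: normr_ge0.
exists (2 * U * V * `|l2_abs x| * `|l2_abs y|) => _ [n _ <-].
have uU' n' : \sum_(k < n') `|u k| ^+ 4 <= U ^+ 4.
  rewrite (le_trans _ (uU n'))//; apply: ler_sum => k _.
  by rewrite (exprM _ 2 2) real_normK ?num_real// -exprM.
have vV' n' : \sum_(k < n') `|v k| ^+ 4 <= V ^+ 4.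
  rewrite (le_trans _ (vV n'))//; apply: ler_sum => k _.
  by rewrite (exprM _ 2 2) real_normK ?num_real// -exprM.
have := @pair_sum_bound _ phiP (fun k => `|u k|) (fun k => `|v k|) _ _ U0 V0
  uU' vV' (l2_abs x) (l2_abs y) m n.
apply: le_trans; rewrite (le_trans _ (ler_norm _))//.
rewrite [leLHS](_ : _ = \sum_(k < n) `|t k|); last by rewrite /= /series/= big_mkord.
apply: ler_sum => k _.
by rewrite /t !normrM.
Qed.

(* Cosine coefficients of a product of two cosine series, with the mean of the
   product removed. *)
Definition cosconv a b m := if m == 0 then 0 else
  2^-1 * (limn (pair_sum addn a b m) + limn (pair_sum absdiff a b m)).

Section WeightedConvolution.
Variables (u v : nat -> R) (U V : R).
Hypotheses (U0 : 0 <= U) (V0 : 0 <= V).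
Hypotheses (uU : forall n, \sum_(k < n) u k ^+ 4 <= U ^+ 4)
           (vV : forall n, \sum_(k < n) v k ^+ 4 <= V ^+ 4).

(** With [N] fixed, the bounds on truncated pair sums survive the limit in the truncation. The
    average of the two pair sums is then handled by convexity of the square. *)
Lemma cosconv_bound x y N :
  \sum_(m < N) cosconv (fun k => u k * x k) (fun k => v k * y k) m ^+ 2 <=
  (2 * U * V * `|x| * `|y|) ^+ 2.
Proof.
set a := fun k => u k * x k; set b := fun k => v k * y k.
set M := _ ^+ 2.
have bnd phi : pairing_bound phi ->
    \sum_(m < N) limn (pair_sum phi a b m) ^+ 2 <= M.
  move=> phiP.
  have c : (fun n => \sum_(m < N) pair_sum phi a b m n ^+ 2) @ \oo -->
      \sum_(m < N) limn (pair_sum phi a b m) ^+ 2.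
    apply: (@cvg_sum_ord _ _ _ _ _ (fun m n => pair_sum phi a b m n ^+ 2)
      (fun m => limn (pair_sum phi a b m) ^+ 2)) => m.
    have /cvg_ex[l hl] := @pair_sum_cvg phi u v U V x y m phiP U0 V0 uU vV.
    rewrite (cvg_lim _ hl)//.
    by rewrite expr2; under eq_fun do rewrite expr2; exact: cvgM.
  by apply: (cvgr_to_le c); apply: nearW => n; exact: sum_pair_sum_le.
have h1 := bnd _ pairing_add; have h2 := bnd _ pairing_absdiff.
rewrite (@le_trans _ _ (2^-1 * (\sum_(m < N) limn (pair_sum addn a b m) ^+ 2 +
  \sum_(m < N) limn (pair_sum absdiff a b m) ^+ 2)))//; last by lra.
rewrite -big_split/= mulr_sumr; apply: ler_sum => m _.
rewrite /cosconv; case: ifP => _.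
  by rewrite expr0n/= mulr_ge0// addr_ge0// sqr_ge0.
have := sqr_ge0 (limn (pair_sum addn a b m) - limn (pair_sum absdiff a b m)); lra.
Qed.

Lemma cosconv_lin x x' y y' c m :
  (cosconv (fun k => u k * (c *: x + x') k) (fun k => v k * y k) m =
   c * cosconv (fun k => u k * x k) (fun k => v k * y k) m +
   cosconv (fun k => u k * x' k) (fun k => v k * y k) m) *
  (cosconv (fun k => u k * x k) (fun k => v k * (c *: y + y') k) m =
   c * cosconv (fun k => u k * x k) (fun k => v k * y k) m +
   cosconv (fun k => u k * x k) (fun k => v k * y' k) m).
Proof.
have l phi : pairing_bound phi ->
  (limn (pair_sum phi (fun k => u k * (c *: x + x') k) (fun k => v k * y k) m) =
   c * limn (pair_sum phi (fun k => u k * x k) (fun k => v k * y k) m) +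
   limn (pair_sum phi (fun k => u k * x' k) (fun k => v k * y k) m)) *
  (limn (pair_sum phi (fun k => u k * x k) (fun k => v k * (c *: y + y') k) m) =
   c * limn (pair_sum phi (fun k => u k * x k) (fun k => v k * y k) m) +
   limn (pair_sum phi (fun k => u k * x k) (fun k => v k * y' k) m)).
  move=> phiP; have cv z w := @pair_sum_cvg phi u v U V z w m phiP U0 V0 uU vV.
  split; apply: cvg_lim => //.
  - rewrite (_ : pair_sum _ _ _ _ = (fun n =>
      c * pair_sum phi (fun k => u k * x k) (fun k => v k * y k) m n +
      pair_sum phi (fun k => u k * x' k) (fun k => v k * y k) m n)).
      by apply: cvgD; [apply: cvgM; [exact: cvg_cst|]|]; exact: cv.
    apply/funext => n; rewrite /pair_sum mulr_sumr -big_split.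
    by apply: eq_bigr => k _; rewrite l2DE l2ZE /=; ring.
  - rewrite (_ : pair_sum _ _ _ _ = (fun n =>
      c * pair_sum phi (fun k => u k * x k) (fun k => v k * y k) m n +
      pair_sum phi (fun k => u k * x k) (fun k => v k * y' k) m n)).
      by apply: cvgD; [apply: cvgM; [exact: cvg_cst|]|]; exact: cv.
    apply/funext => n; rewrite /pair_sum mulr_sumr -big_split.
    by apply: eq_bigr => k _; rewrite l2DE l2ZE /=; ring.
rewrite /cosconv; case: ifP => _; first by rewrite mulr0 addr0.
by rewrite !(l _ pairing_add) !(l _ pairing_absdiff); split; ring.
Qed.

End WeightedConvolution.

Lemma sum_weighted_le x (v : nat -> R) (c : R) n : (forall k, `|v k| <= c) ->
  \sum_(k < n) (v k * x k) ^+ 2 <= (c * `|x|) ^+ 2.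
Proof.
move=> vc; rewrite exprMn (le_trans _ (ler_wpM2l (sqr_ge0 c) (l2_sum_le x n)))//.
rewrite mulr_sumr; apply: ler_sum => k _; rewrite exprMn ler_wpM2r ?sqr_ge0//.
by rewrite -[v k ^+ 2]real_normK ?num_real// lerXn2r// nnegrE (le_trans _ (vc k)).
Qed.

Lemma weight_le (u : nat -> R) (U : R) k : 0 <= U ->
  (forall n, \sum_(k < n) u k ^+ 4 <= U ^+ 4) -> `|u k| <= U.
Proof.
move=> U0 uU; rewrite -(@ler_pXn2r _ 4)// ?nnegrE//.
rewrite (exprM _ 2 2) real_normK ?num_real// -exprM (le_trans _ (uU k.+1))//.
rewrite big_ord_recr/= lerDr sumr_ge0// => i _.
by rewrite (exprM _ 2 2) sqr_ge0.
Qed.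

Let sum_delta i n : \sum_(k < n) ((k : nat) == i)%:R ^+ 2 = (i < n)%N%:R :> R.
Proof.
elim: n => [|n IH]; first by rewrite big_ord0.
rewrite big_ord_recr/= IH [in RHS]ltnS [in RHS]leq_eqVlt eq_sym.
have [->|_] := eqVneq n i; first by rewrite ltnn/= add0r expr1n.
by rewrite expr0n/= addr0.
Qed.

Lemma l2_unit_subproof i : square_summable (fun k => (k == i)%:R : R).
Proof. by exists 1 => n; rewrite sum_delta lern1; case: (i < n)%N. Qed.

Definition l2_unit i := mkl2 (l2_unit_subproof i).

Lemma l2_sumE I (r : seq I) (P : pred I) (F : I -> l2 R) k :
  (\sum_(i <- r | P i) F i) k = \sum_(i <- r | P i) F i k.
Proof. exact: (big_morph (fun x : l2 R => x k)). Qed.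

Lemma l2_truncE x N k :
  (x - \sum_(i < N) x i *: l2_unit i) k = (N <= k)%N%:R * x k.
Proof.
rewrite l2BE l2_sumE.
have -> : \sum_(i < N) (x i *: l2_unit i) k = (k < N)%N%:R * x k.
  elim: N => [|N IH]; first by rewrite big_ord0 mul0r.
  rewrite big_ord_recr IH l2ZE/= [in RHS]ltnS [in RHS]leq_eqVlt.
  have [->|_] := eqVneq k N; first by rewrite ltnn mul0r add0r mulr1 mul1r.
  by rewrite mulr0 addr0.
by rewrite [(N <= k)%N]leqNgt; case: (k < N)%N; rewrite /= ?mul1r ?mul0r ?subrr ?subr0.
Qed.

Lemma sum_tail_small g (M e : R) : 0 < e ->
  (forall n, \sum_(k < n) g k <= M) -> exists N : nat,
  forall n, \sum_(k < n) (N <= k)%N%:R * g k <= e.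
Proof.
move=> e0 gM; pose S := [set \sum_(k < n) g k | n in [set: nat]].
have hS : has_sup S.
  by split; [exists 0, 0; rewrite ?big_ord0|exists M => _ [n _ <-]].
(* At [N] the partial sum is within [e] of the supremum, so no later partial sum exceeds it by more
   than [e]. *)
have [_ [N _ <-] hN] := sup_adherent e0 hS; exists N => n.
have -> : \sum_(k < n) (N <= k)%N%:R * g k =
    \sum_(k < maxn n N) g k - \sum_(k < N) g k.
  elim: n => [|n IH]; first by rewrite big_ord0 max0n subrr.
  rewrite big_ord_recr/= IH; have [Nn|nN] := leqP N n.
    by rewrite mul1r !(maxn_idPl _)// ?leqW// big_ord_recr/= addrAC.
  by rewrite mul0r addr0 !(maxn_idPr _)// ltnW.
have : \sum_(k < maxn n N) g k <= sup S.
  by apply: ub_le_sup; [exact: hS.2|exists (maxn n N)].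
by lra.
Qed.

Lemma tail_small (u : nat -> R) (M e : R) : 0 < e ->
  (forall n, \sum_(k < n) u k ^+ 4 <= M) -> exists N : nat,
  forall n, \sum_(k < n) ((N <= k)%N%:R * u k) ^+ 4 <= e ^+ 4.
Proof.
move=> e0 uM; have [N hN] := @sum_tail_small (fun k => u k ^+ 4) _ _ (exprn_gt0 4 e0) uM.
exists N => n.
rewrite (le_trans _ (hN n))// ler_sum// => k _; rewrite exprMn ler_wpM2r//.
  by rewrite (exprM _ 2 2) sqr_ge0.
by case: (N <= k)%N; rewrite ?expr1n ?expr0n.
Qed.

Section Operators.
Variables (u : nat -> R) (U : R).
Hypotheses (U0 : 0 <= U) (uU : forall n, \sum_(k < n) u k ^+ 4 <= U ^+ 4).

Lemma wmul_subproof x : square_summable (fun k => u k * x k).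
Proof.
exists ((U * `|x|) ^+ 2) => n; apply: sum_weighted_le => k; exact: weight_le.
Qed.

Lemma wconv_subproof x y :
  square_summable (cosconv (fun k => u k * x k) (fun k => u k * y k)).
Proof. by eexists => n; exact: (cosconv_bound U0 U0 uU uU). Qed.

Definition wmul x := mkl2 (wmul_subproof x).
Definition wconv x y := mkl2 (wconv_subproof x y).

Lemma wmul_linear : linear wmul.
Proof.
move=> c x y; apply: l2_ext => k; transitivity (u k * (c * x k + y k)) => //.
by rewrite l2DE l2ZE /=; ring.
Qed.

Lemma wmul_bound x : `|wmul x| <= U * `|x|.
Proof.
apply: l2_norm_le => [|n]; first by rewrite mulr_ge0.
exact: (sum_weighted_le x n (fun k => weight_le k U0 uU)).
Qed.

Lemma wconv_linearr x : linear (wconv x).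
Proof.
by move=> c y y'; apply: l2_ext => m; exact: (cosconv_lin U0 U0 uU uU x x y y' c m).2.
Qed.

Lemma wconv_linearl y : linear (wconv^~ y).
Proof.
by move=> c x x'; apply: l2_ext => m; exact: (cosconv_lin U0 U0 uU uU x x' y y c m).1.
Qed.

Lemma wconv_bound x y : `|wconv x y| <= 2 * U * U * `|x| * `|y|.
Proof. by apply: l2_norm_le => [|n]; [rewrite !mulr_ge0|exact: cosconv_bound]. Qed.

Lemma wconv0 x y : wconv x y 0 = 0. Proof. by []. Qed.

(* The linearization is a compact perturbation of the identity: weights of
   high modes are small. *)
Lemma tail_compact (c : R) (x0 : l2 R) : exists N : nat, forall x,
  let K x := c *: wmul x - (wconv x0 x + wconv x x0) in
  `|K (x - \sum_(i < N) x i *: l2_unit i)| <= 2^-1 * `|x|.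
Proof.
(* With tail weights of size [e], the three terms of [K] add up to at most [e (|c| + 4 U |x0|) |x|],
   and [e D = 1/2]. *)
pose D := `|c| + 4 * U * `|x0| + 1.
have D0 : 0 < D by rewrite ltr_wpDl// addr_ge0// !mulr_ge0.
pose e := (2 * D)^-1.
have e0 : 0 < e by rewrite invr_gt0 mulr_gt0.
have [N vN] := tail_small e0 uU; exists N => x /=.
set v := fun k => (N <= k)%N%:R * u k.
have ve k : `|v k| <= e by exact: weight_le (ltW e0) vN.
set z := x - _.
(* Truncating the sequence is the same as truncating the weight. The estimates with two different
   weights then apply with [e] in place of one factor [U]. *)
have uz : (fun k => u k * z k) = (fun k => v k * x k).
  by apply/funext => k; rewrite l2_truncE /v; ring.
have h1 : `|wmul z| <= e * `|x|.
  apply: l2_norm_le => [|n]; first by rewrite mulr_ge0// ltW.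
  rewrite /wmul/= (eq_bigr (fun k : 'I_n => (v k * x k) ^+ 2)).
    exact: sum_weighted_le.
  by move=> k _; have := congr1 (fun f => f (k : nat)) uz => /= ->.
have h2 : `|wconv x0 z| <= 2 * U * e * `|x0| * `|x|.
  apply: l2_norm_le => [|n]; first by rewrite !mulr_ge0// ltW.
  by rewrite /wconv/= uz; apply: cosconv_bound => //; exact: ltW.
have h3 : `|wconv z x0| <= 2 * e * U * `|x| * `|x0|.
  apply: l2_norm_le => [|n]; first by rewrite !mulr_ge0// ltW.
  by rewrite /wconv/= uz; apply: cosconv_bound => //; exact: ltW.
rewrite (le_trans (ler_normB _ _))// normrZ.
rewrite (le_trans (lerD (ler_wpM2l (normr_ge0 c) h1) (ler_normD _ _)))//.
have eD : e * (`|c| + 4 * U * `|x0|) <= 2^-1.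
  have : e * D = 2^-1 by rewrite /e; field; rewrite gt_eqF.
  by rewrite /D; lra.
have := ler_wpM2r (normr_ge0 x) eD; lra.
Qed.

End Operators.

End Convolution.

(** * Fourier series on the torus *)

Section TorusIntegral.
Context {R : realType}.
Local Notation mu := (@lebesgue_measure R).
Local Notation T := (@torus R).
Local Notation intg f := (mu.-integrable T (EFin \o f)).
Implicit Types f g h : R -> R.

Lemma measurable_torus : measurable (T : set (measurableTypeR R)).
Proof. exact: measurable_itv. Qed.
Hint Resolve measurable_torus : core.

Lemma ae_lebesgue_filter : Filter (almost_everywhere mu).
Proof. exact: ae_filter_ringOfSetsType. Qed.

Lemma torus_measure : mu T = (2 * pi)%:E.
Proof.
rewrite /torus lebesgue_measure_itv/= lte_fin ifT.
  by rewrite -EFinD opprK mulr_natl mulr2n.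
by rewrite gtrN// pi_gt0.
Qed.

Lemma torus_measure_lty : (mu T < +oo)%E.
Proof. by rewrite torus_measure ltry. Qed.

Lemma intg_bounded f (M : R) : measurable_fun setT f ->
  (forall x, `|f x| <= M) -> intg f.
Proof.
move=> mf fM; apply: measurable_bounded_integrable => //.
- exact: torus_measure_lty.
- exact: measurable_funTS.
- exists M; split=> [|t Mt x _]; first exact: num_real.
  by rewrite /= (le_trans (fM x))// ltW.
Qed.

Lemma intgM_bounded f h (M : R) : intg f -> measurable_fun setT h ->
  (forall x, `|h x| <= M) -> intg (fun x => f x * h x).
Proof.
move=> fi mh hM; rewrite (_ : _ \o _ = (EFin \o f) \* (EFin \o h))%E//.
apply: integrableMl => //; first exact: measurable_funTS.
exists M; split=> [|t Mt x _]; first exact: num_real.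
by rewrite /= (le_trans (hM x))// ltW.
Qed.

Lemma intgZ c f : intg f -> intg (fun x => c * f x).
Proof.
move=> fi; rewrite (_ : _ \o _ = (fun x => c%:E * (EFin \o f) x)%E)//.
exact: integrableZl.
Qed.

Lemma intgD f g : intg f -> intg g -> intg (fun x => f x + g x).
Proof.
move=> fi gi; rewrite (_ : _ \o _ = (EFin \o f) \+ (EFin \o g))%E//.
exact: integrableD.
Qed.

Lemma intgB f g : intg f -> intg g -> intg (fun x => f x - g x).
Proof.
move=> fi gi; rewrite (_ : _ \o _ = (EFin \o f) \- (EFin \o g))%E//.
exact: integrableB.
Qed.

Lemma tintD f g : intg f -> intg g -> tint (fun x => f x + g x) = tint f + tint g.
Proof. exact: RintegralD. Qed.

Lemma tintB f g : intg f -> intg g -> tint (fun x => f x - g x) = tint f - tint g.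
Proof. exact: RintegralB. Qed.

Lemma tintZ c f : intg f -> tint (fun x => c * f x) = c * tint f.
Proof. exact: RintegralZl. Qed.

Lemma tint_cst c : tint (fun=> c : R) = 2 * pi * c.
Proof.
rewrite /tint Rintegral_cst//; transitivity (c * fine (mu T)) => //.
by rewrite torus_measure mulrC.
Qed.

Lemma eq_tint f g : (forall x, f x = g x) -> tint f = tint g.
Proof. by move=> fg; congr tint; exact/funext. Qed.

Lemma tint_sum n (f : nat -> R -> R) : (forall k, intg (f k)) ->
  intg (fun x => \sum_(k < n) f k x) /\
  tint (fun x => \sum_(k < n) f k x) = \sum_(k < n) tint (f k).
Proof.
move=> fi; elim: n => [|n [IHi IH]].
  have -> : (fun x => \sum_(k < 0) f k x) = (fun=> 0 : R).
    by apply/funext => x; rewrite big_ord0.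
  split; first by apply: (@intg_bounded _ 0) => // x; rewrite normr0.
  by rewrite tint_cst mulr0 big_ord0.
have -> : (fun x => \sum_(k < n.+1) f k x) =
    (fun x => \sum_(k < n) f k x + f n x).
  by apply/funext => x; rewrite big_ord_recr.
by split; [exact: intgD|rewrite tintD// IH big_ord_recr].
Qed.

Lemma eqae_tint f g : intg f -> intg g -> eqae f g -> tint f = tint g.
Proof.
move=> fi gi fg; rewrite /tint /Rintegral; congr fine.
apply: ae_eq_integral => //.
- exact: measurable_int fi.
- exact: measurable_int gi.
- by apply: filterS fg => x h Tx; rewrite (h Tx).
Qed.

Lemma L2per_intg f : L2per f -> intg f.
Proof.
move=> [mf _ f2]. apply: (@le_integrable _ _ R mu T measurable_torus _
  (EFin \o (fun x => 1 + f x ^+ 2))) => //.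
- exact/measurable_EFinP/measurable_funTS.
- move=> x _; rewrite /= lee_fin [leRHS]ger0_norm ?addr_ge0 ?sqr_ge0//.
  rewrite ler_norml; have := sqr_ge0 (f x - 1); have := sqr_ge0 (f x + 1); lra.
- apply: (@intgD (fun=> 1) (fun x => f x ^+ 2)) => //.
  by apply: (@intg_bounded _ 1) => // x; rewrite normr1.
Qed.

Lemma L2per_intgM f g : L2per f -> L2per g -> intg (fun x => f x * g x).
Proof.
move=> [mf _ f2] [mg _ g2]; apply: (@le_integrable _ _ R mu T measurable_torus _
  (EFin \o (fun x => f x ^+ 2 + g x ^+ 2))) => //.
- by apply/measurable_EFinP/measurable_funTS; exact: measurable_funM.
- move=> x _; rewrite /= lee_fin [leRHS]ger0_norm ?addr_ge0 ?sqr_ge0//.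
  rewrite ler_norml; have := sqr_ge0 (f x - g x); have := sqr_ge0 (f x + g x).
  by have := sqr_ge0 (f x); have := sqr_ge0 (g x); lra.
- exact: intgD.
Qed.

Lemma L2perZ c f : L2per f -> L2per (fun x => c * f x).
Proof.
move=> [mf pf f2]; split.
- exact: measurable_funM.
- by move=> x; rewrite pf.
- have -> : (fun x => ((c * f x) ^+ 2)%:E) =
      (EFin \o (fun x => c ^+ 2 * f x ^+ 2)).
    by apply/funext => x /=; rewrite exprMn.
  exact: intgZ.
Qed.

Lemma L2perD f g : L2per f -> L2per g -> L2per (fun x => f x + g x).
Proof.
move=> Lf Lg; have fgi := L2per_intgM Lf Lg.
case: Lf Lg => [mf pf f2] [mg pg g2]; split.
- exact: measurable_funD.
- by move=> x; rewrite pf pg.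
- have -> : (fun x => ((f x + g x) ^+ 2)%:E) =
      (EFin \o (fun x => f x ^+ 2 + 2 * (f x * g x) + g x ^+ 2)).
    by apply/funext => x /=; congr EFin; ring.
  by apply: intgD => //; apply: intgD => //; exact: intgZ.
Qed.

Lemma torusN x : T (- x) <-> T x.
Proof. by rewrite /torus/= !in_itv/= lerN2 lerNl andbC. Qed.

Lemma ae_oppr (P : R -> Prop) : {ae mu, forall x, P x} -> {ae mu, forall x, P (- x)}.
Proof.
move=> [N [mN N0 PN]]; exists (-%R @^-1` N); split.
- by rewrite -[X in measurable X]setTI; exact: (@oppr_measurable R setT).
- by rewrite -[RHS]N0 -(lebesgue_measureN mN).
- by move=> x /= Px; apply: PN.
Qed.

Let opp : measurableTypeR R -> measurableTypeR R := -%R.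

Let mopp : measurable_fun setT opp. Proof. exact: oppr_measurable. Qed.

Let preimage_opp_torus : opp @^-1` T = T.
Proof. by apply/seteqP; split=> x /torusN. Qed.

Lemma intg_oppr f : measurable_fun setT f -> intg f -> intg (fun x => f (- x)).
Proof.
move=> mf /integrableP[_ fi]; apply/integrableP; split.
  apply/measurable_EFinP; apply: measurable_funTS.
  by apply: measurableT_comp => //; exact: oppr_measurable.
apply: le_lt_trans fi; rewrite le_eqVlt; apply/orP; left; apply/eqP/esym.
transitivity (\int[pushforward mu opp]_(x in T) `|(f x)%:E|)%E.
  apply: eq_measure_integral; try exact: mopp.
  by move=> A mA _; exact/esym/lebesgue_measureN.
rewrite -[in RHS]preimage_opp_torus.
rewrite (@ge0_integral_pushforward _ _ _ _ R opp mopp mu T (fun x => `|(f x)%:E|)%E)//=.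
by apply: measurable_funTS; do 2 apply: measurableT_comp => //.
Qed.

Lemma tint_oppr f : measurable_fun setT f -> intg f ->
  tint (fun x => f (- x)) = tint f.
Proof.
move=> mf fi; rewrite /tint /Rintegral; congr fine; apply/esym.
transitivity (\int[pushforward mu opp]_(x in T) (f x)%:E)%E.
  apply: eq_measure_integral; try exact: mopp.
  by move=> A mA _; exact/esym/lebesgue_measureN.
rewrite -[in RHS]preimage_opp_torus.
rewrite (@integral_pushforward _ _ _ _ R opp mopp mu T (EFin \o f))//=.
- exact/measurable_EFinP.
- by rewrite preimage_opp_torus; exact: intg_oppr.
Qed.

End TorusIntegral.
#[global] Hint Resolve measurable_torus : core.

(** * Uniqueness of Fourier coefficients for integrable functions *)

Section TrigonometricPolynomials.
Context {R : realType}.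
Local Notation mu := (@lebesgue_measure R).
Local Notation T := (@torus R).
Local Notation intg f := (mu.-integrable T (EFin \o f)).
Implicit Types f g h : R -> R.

Lemma measurable_cosM (a : R) : measurable_fun setT (fun x => cos (a * x)).
Proof.
apply: continuous_measurable_fun => x; apply: continuous_comp; last exact: continuous_cos.
by apply: continuousM; [exact: cvg_cst|exact: cvg_id].
Qed.

Lemma measurable_sinM (a : R) : measurable_fun setT (fun x => sin (a * x)).
Proof.
apply: continuous_measurable_fun => x; apply: continuous_comp; last exact: continuous_sin.
by apply: continuousM; [exact: cvg_cst|exact: cvg_id].
Qed.

Lemma cos_absdiff n m (x : R) :
  cos ((absdiff n m)%:R * x) = cos (n%:R * x - m%:R * x).
Proof.
rewrite -mulrBl /absdiff; have [nm|mn] := leqP n m.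
  move: (nm); rewrite -subn_eq0 => /eqP ->; rewrite add0n natrB//.
  by rewrite -opprB mulNr cosN.
have /eqP -> : (m - n == 0)%N by rewrite subn_eq0 ltnW.
by rewrite addn0 natrB// ltnW.
Qed.

Lemma cosMcos n m (x : R) : cos (n%:R * x) * cos (m%:R * x) =
  2^-1 * (cos ((n + m)%:R * x) + cos ((absdiff n m)%:R * x)).
Proof. by rewrite cos_absdiff cosB natrD mulrDl cosD; field. Qed.

(** Presented as a linear span, so that orthogonality to all cosines and sines extends by induction.
    Closure under products follows from the product-to-sum formulas. *)
Inductive trig_poly : (R -> R) -> Prop :=
| trig_cos n : trig_poly (fun x => cos (n%:R * x))
| trig_sin n : trig_poly (fun x => sin (n%:R * x))
| trig_add f g : trig_poly f -> trig_poly g -> trig_poly (fun x => f x + g x)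
| trig_scale c f : trig_poly f -> trig_poly (fun x => c * f x).

Lemma eq_trig_poly f g : trig_poly f -> (forall x, f x = g x) -> trig_poly g.
Proof. by move=> + /funext <-. Qed.

Lemma trig_cst c : trig_poly (fun=> c).
Proof.
apply: eq_trig_poly (trig_scale c (trig_cos 0)) _ => x.
by rewrite mul0r cos0 mulr1.
Qed.

Let trig_sinB n m : trig_poly (fun x => sin (n%:R * x - m%:R * x)).
Proof.
have [nm|mn] := leqP n m.
  apply: eq_trig_poly (trig_scale (-1) (trig_sin (m - n))) _ => x.
  by rewrite natrB// mulN1r -sinN; congr sin; ring.
apply: eq_trig_poly (trig_sin (n - m)) _ => x.
by rewrite natrB ?mulrBl// ltnW.
Qed.

Let trig_cosB n m : trig_poly (fun x => cos (n%:R * x - m%:R * x)).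
Proof. by apply: eq_trig_poly (trig_cos (absdiff n m)) _ => x; rewrite cos_absdiff. Qed.

Lemma trig_mul f g : trig_poly f -> trig_poly g -> trig_poly (fun x => f x * g x).
Proof.
move=> tf; elim: tf g => {f} [n|n|f1 f2 _ IH1 _ IH2|c f _ IH] g tg; last 2 first.
- by apply: eq_trig_poly (trig_add (IH1 _ tg) (IH2 _ tg)) _ => x; rewrite mulrDl.
- by apply: eq_trig_poly (trig_scale c (IH _ tg)) _ => x; rewrite mulrA.
- elim: tg => {g} [m|m|g1 g2 _ IH1 _ IH2|c g _ IH].
  + apply: eq_trig_poly (trig_scale 2^-1 (trig_add (trig_cos (n + m)) (trig_cosB n m))) _ => x.
    by rewrite cosB natrD mulrDl cosD; field.
  + apply: eq_trig_poly (trig_scale 2^-1 (trig_add (trig_sin (n + m)) (trig_sinB m n))) _ => x.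
    by rewrite sinB natrD mulrDl sinD; field.
  + by apply: eq_trig_poly (trig_add IH1 IH2) _ => x; rewrite mulrDr.
  + by apply: eq_trig_poly (trig_scale c IH) _ => x; rewrite mulrCA.
- elim: tg => {g} [m|m|g1 g2 _ IH1 _ IH2|c g _ IH].
  + apply: eq_trig_poly (trig_scale 2^-1 (trig_add (trig_sin (n + m)) (trig_sinB n m))) _ => x.
    by rewrite sinB natrD mulrDl sinD; field.
  + apply: eq_trig_poly (trig_scale 2^-1 (trig_add (trig_cosB n m)
      (trig_scale (-1) (trig_cos (n + m))))) _ => x.
    by rewrite cosB natrD mulrDl cosD; field.
  + by apply: eq_trig_poly (trig_add IH1 IH2) _ => x; rewrite mulrDr.
  + by apply: eq_trig_poly (trig_scale c IH) _ => x; rewrite mulrCA.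
Qed.

Lemma trig_exp f n : trig_poly f -> trig_poly (fun x => f x ^+ n).
Proof.
move=> tf; elim: n => [|n IH]; first exact: trig_cst.
by apply: eq_trig_poly (trig_mul tf IH) _ => x; rewrite exprS.
Qed.

Lemma trig_poly_bounded g : trig_poly g ->
  measurable_fun setT g /\ exists M : R, forall x, `|g x| <= M.
Proof.
elim=> {g} [n|n|f g _ [mf [M fM]] _ [mg [N gN]]|c f _ [mf [M fM]]].
- by split; [exact: measurable_cosM|exists 1 => x; exact: cos_max].
- by split; [exact: measurable_sinM|exists 1 => x; exact: sin_max].
- split; first exact: measurable_funD.
  by exists (M + N) => x; rewrite (le_trans (ler_normD _ _))// lerD.
- split; first exact: measurable_funM.
  by exists (`|c| * M) => x; rewrite normrM ler_wpM2l.
Qed.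

Lemma intgM_trig f g : intg f -> trig_poly g -> intg (fun x => f x * g x).
Proof.
by move=> fi /trig_poly_bounded[mg [M gM]]; exact: intgM_bounded gM.
Qed.

Lemma tintM_trig0 f g : intg f ->
  (forall n, tint (fun x => f x * cos (n%:R * x)) = 0) ->
  (forall n, tint (fun x => f x * sin (n%:R * x)) = 0) ->
  trig_poly g -> tint (fun x => f x * g x) = 0.
Proof.
move=> fi fc fs; elim=> {g} // [g h tg IHg th IHh|c g tg IH].
- rewrite -[RHS]addr0 -{1}IHg -IHh -tintD; [|exact: intgM_trig..].
  by apply: eq_tint => x; rewrite mulrDr.
- rewrite -[RHS](mulr0 c) -IH -tintZ; last exact: intgM_trig.
  by apply: eq_tint => x; rewrite mulrCA.
Qed.

Lemma bernoulli_ineq (a : R) n : -1 <= a -> 1 + n%:R * a <= (1 + a) ^+ n.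
Proof.
move=> a1; elim: n => [|n IH]; first by rewrite mul0r addr0 expr0.
rewrite exprS (@le_trans _ _ ((1 + a) * (1 + n%:R * a)))//; last first.
  by rewrite ler_wpM2l//; lra.
rewrite -natr1; have : 0 <= n%:R * a ^+ 2 by rewrite mulr_ge0// sqr_ge0.
by lra.
Qed.

(* Indicator of [w < 1/2] in the limit, and a polynomial in [w]. *)
Let step n (w : R) : R := (1 - w ^+ n) ^+ (2 ^ n)%N.

Let step_bound n (w : R) : 0 <= w <= 1 -> 0 <= step n w <= 1.
Proof.
move=> /andP[w0 w1]; have h : 0 <= 1 - w ^+ n <= 1.
  by rewrite subr_ge0 exprn_ile1//= gerBl exprn_ge0.
by case/andP: h => h0 h1; rewrite exprn_ge0//= exprn_ile1.
Qed.

(** Bernoulli's inequality squeezes [step n w] between [1 - (2 w)^n] and [1], as in the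
    Brosowski-Deutsch proof of the Stone-Weierstrass theorem. *)
Let step_lt (w : R) : 0 <= w < 2^-1 -> step n w @[n --> \oo] --> (1 : R).
Proof.
move=> /andP[w0 w1].
have w2 : `|2 * w| < 1 by rewrite ger0_norm; lra.
apply: (@squeeze_cvgr _ _ _ _ (fun n => 1 - (2 * w) ^+ n) (fun=> 1)).
- apply: nearW => n; have w1' : w <= 1 by lra.
  have := @step_bound n w; rewrite w0 w1' => /(_ isT)/andP[_ ->].
  rewrite andbT; have := @bernoulli_ineq (- w ^+ n) (2 ^ n)%N.
  rewrite lerN2 exprn_ile1// => /(_ isT); apply: le_trans.
  by rewrite exprMn natrX mulrN.
- by rewrite -[X in _ --> X]subr0; apply: cvgB; [exact: cvg_cst|exact: cvg_expr].
- exact: cvg_cst.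
Qed.

(** Multiplying [step n w] by [(1 + w^n)^(2^n)] gives at most [1], and by Bernoulli that factor is
    at least [(2 w)^n], which tends to infinity. *)
Let step_gt w : 2^-1 < w <= 1 -> step n w @[n --> \oo] --> (0 : R).
Proof.
move=> /andP[w0 w1].
have w2 : `|(2 * w)^-1| < 1.
  by rewrite ger0_norm ?invr_ge0 ?invf_lt1; lra.
apply: (@squeeze_cvgr _ _ _ _ (fun=> 0) (fun n => (2 * w)^-1 ^+ n)).
- apply: nearW => n; have w0' : 0 <= w by lra.
  have := @step_bound n w; rewrite w0' w1 => /(_ isT)/andP[-> _].
  have p0 : 0 <= w ^+ n by rewrite exprn_ge0.
  have p1 : w ^+ n <= 1 by rewrite exprn_ile1.
  have q0 : 0 < (2 * w) ^+ n by rewrite exprn_gt0//; lra.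
  rewrite exprVn -[leRHS]mul1r ler_pdivlMr//.
  have h : (2 * w) ^+ n <= (1 + w ^+ n) ^+ (2 ^ n)%N.
    have := @bernoulli_ineq (w ^+ n) (2 ^ n)%N; rewrite exprMn natrX; lra.
  have s0 : 0 <= step n w by rewrite exprn_ge0// subr_ge0.
  rewrite (le_trans (ler_wpM2l s0 h))// /step -exprMn exprn_ile1//.
    by rewrite mulr_ge0//; lra.
  by have := sqr_ge0 (w ^+ n); lra.
- exact: cvg_cst.
- exact: cvg_expr.
Qed.

Let ae_neq (a : R) : {ae mu, forall x, x != a}.
Proof.
exists [set a]; split => [||x /= /negP/negPn/eqP//].
  exact: measurable_set1.
exact: lebesgue_measure_set1.
Qed.

(** The distance [d] to [x0] may exceed [pi], where the cosine increases again. It stays below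
    [2 pi - r], so its reflection [2 pi - d] is still larger than [r]. *)
Let cos_ball (x0 r x : R) : 0 < r -> `|x0| + r < pi -> T x ->
  (`|x - x0| < r -> cos r < cos (x - x0)) /\
  (r < `|x - x0| -> cos (x - x0) < cos r).
Proof.
move=> r0 x0r; rewrite /torus/= in_itv/= -ler_norml => Tx.
have d0 := normr_ge0 (x - x0); have x00 := normr_ge0 x0.
have dT : `|x - x0| < 2 * pi - r by rewrite (le_lt_trans (ler_normB _ _))//; lra.
rewrite -(cos_norm (x - x0)); move: `|x - x0| d0 dT => d d0 dT; split=> dr.
  by rewrite ltr_cos// in_itv/=; lra.
have [dpi|dpi] := leP d pi; first by rewrite ltr_cos// in_itv/=; lra.
have <- : cos (2 * pi - d) = cos d.
  have -> : 2 * pi - d = - d + pi *+ 2 by ring.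
  by rewrite cosD2pi cosN.
by rewrite ltr_cos// ?in_itv/=; lra.
Qed.

Lemma ball_integral0 f (x0 r : R) : measurable_fun setT f -> intg f ->
  (forall n, tint (fun x => f x * cos (n%:R * x)) = 0) ->
  (forall n, tint (fun x => f x * sin (n%:R * x)) = 0) ->
  0 < r -> `|x0| + r < pi -> (\int[mu]_(x in ball x0 r) (f x)%:E = 0)%E.
Proof.
move=> mf fi fc fs r0 x0r.
(* A trigonometric polynomial with values in [[0, 1]], below [1/2] inside the ball and above [1/2]
   on the rest of the torus outside the closed ball. Hence [step n (w x)] tends to the indicator of
   the ball. *)
pose w (x : R) : R := 2^-1 * (1 - 2^-1 * (cos (x - x0) - cos r)).
have w01 x : 0 <= w x <= 1.
  have := cos_le1 (x - x0); have := cos_geN1 (x - x0).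
  by have := cos_le1 r; have := cos_geN1 r; rewrite /w; lra.
have tw : trig_poly w.
  have tc : trig_poly (fun x => cos (x - x0)).
    apply: eq_trig_poly (trig_add (trig_scale (cos x0) (trig_cos 1))
      (trig_scale (sin x0) (trig_sin 1))) _ => x.
    by rewrite cosB mul1r; ring.
  apply: eq_trig_poly (trig_add (trig_cst (2^-1 + 4^-1 * cos r))
    (trig_scale (- 4^-1) tc)) _ => x.
  by rewrite /w; field.
have ts n : trig_poly (fun x => step n (w x)).
  apply: trig_exp; apply: eq_trig_poly (trig_add (trig_cst 1)
    (trig_scale (-1) (trig_exp n tw))) _ => x.
  by rewrite mulN1r.
have mB : measurable (ball x0 r : set R) by exact: measurable_ball.
have BT : T `&` ball x0 r = ball x0 r.
  apply/seteqP; split=> x /=; [by case|rewrite /ball/= => xr; split=> //].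
  rewrite /torus/= in_itv/= -ler_norml; have -> : x = x0 - (x0 - x) by ring.
  by rewrite (le_trans (ler_normB _ _))// ltW//; lra.
have [] := @dominated_convergence _ _ R mu T measurable_torus
  (fun n => EFin \o (fun x => f x * step n (w x)))
  ((EFin \o f) \_ (ball x0 r)) (EFin \o (Num.norm \o f)).
- by move=> n; exact: measurable_int (intgM_trig fi (ts n)).
- apply/measurable_restrict; [exact: mB|exact: measurable_torus|].
  by apply/measurable_EFinP; exact: measurable_funTS.
(* At the two end points of the ball [w] equals [1/2] and neither limit of [step] applies; they form
   a null set. *)
- move: (ae_neq (x0 - r)) (ae_neq (x0 + r)).
  apply: (@filterS2 _ _ ae_lebesgue_filter) => x xr xr' Tx.
  have [hlt hgt] := cos_ball r0 x0r Tx.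
  have EFinc (l : R) : f x * step n (w x) @[n --> \oo] --> l ->
      (EFin \o (fun x => f x * step n (w x))) x @[n --> \oo] --> l%:E.
    by move=> h; apply: cvg_EFin => //; exact: nearW.
  rewrite patchE; case: ifPn => [|].
    rewrite inE/= /ball/= distrC => /hlt h; apply: EFinc.
    rewrite -[X in _ --> X]mulr1; apply: cvgM; first exact: cvg_cst.
    by apply: step_lt; have /andP[-> _] := w01 x; rewrite /w; lra.
  rewrite notin_setE/= /ball/= distrC => /negP; rewrite -leNgt le_eqVlt => /predU1P[h|/hgt h].
    exfalso; have [p|p] := leP 0 (x - x0).
      by move: xr' => /eqP; apply; move: h; rewrite ger0_norm// => ->; ring.
    by move: xr => /eqP; apply; move: h; rewrite ltr0_norm// => ->; ring.
  apply: EFinc; rewrite -[X in _ --> X](mulr0 (f x)); apply: cvgM; first exact: cvg_cst.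
  by apply: step_gt; have /andP[_ ->] := w01 x; rewrite andbT /w; lra.
- exact: integrable_norm.
- apply: aeW => x n _; rewrite /= lee_fin normrM ler_piMr//.
  by have /andP[s0 s1] := step_bound n (w01 x); rewrite ger0_norm.
move=> _ _ lim.
rewrite -BT integral_mkcondr.
have h n : (\int[mu]_(x in T) (EFin \o (fun x => f x * step n (w x))%R) x = 0)%E.
  rewrite -(fineK (integrable_fin_num measurable_torus (intgM_trig fi (ts n)))).
  by congr EFin; exact: tintM_trig0 (ts n).
have lim0 : (fun n => \int[mu]_(x in T) (EFin \o (fun x => f x * step n (w x))%R) x)%E
    @ \oo --> (0 : \bar R)%E.
  by under eq_fun do rewrite h; exact: cvg_cst.
exact: (cvg_unique _ lim lim0).
Qed.

(* An integrable function with vanishing Fourier coefficients has mean zero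
   on every small ball, since indicators of balls are bounded a.e. limits of
   trigonometric polynomials. *)
Lemma fourier_coef_uniqueness f : measurable_fun setT f -> intg f ->
  (forall n, tint (fun x => f x * cos (n%:R * x)) = 0) ->
  (forall n, tint (fun x => f x * sin (n%:R * x)) = 0) ->
  eqae f (fun=> 0).
Proof.
move=> mf fi fc fs.
have locF := integrable_locally_restrict measurable_torus fi.
pose E (x : R) n : set R := ball x (n.+1%:R^-1).
have nE x : nicely_shrinking x (E x).
  split=> [n|]; first exact: measurable_ball.
  exists (1, fun n => PosNum (harmonic_gt0 n)); split => //=.
  - exact: cvg_harmonic.
  - by move=> n.
  - by move=> n; rewrite mul1e.
have := lebesgue_differentiation locF.
move: (ae_neq pi) (ae_neq (- pi)).
apply: (@filterS3 _ _ ae_lebesgue_filter) => x xpi xNpi lx Tx.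
have := nice_lebesgue_differentiation nE locF lx.
have -> : (f \_ T) x = f x by rewrite patchE ifT// inE.
move=> h.
have h0 : ((mu (E x n))^-1 * \int[mu]_(y in E x n) ((f \_ T) y)%:E)%E
    @[n --> \oo] --> (0 : \bar R)%E.
  apply: cvg_near_cst.
  (* Discarding the points [pi] and [- pi] leaves room for small balls inside the torus, on which
     the integral vanishes. *)
  have xpi' : 0 < pi - `|x|.
    move: Tx; rewrite /torus/= in_itv/= => /andP[x1 x2].
    by rewrite subr_gt0 ltr_norml !lt_neqAle x1 x2 eq_sym xNpi xpi.
  near=> n.
  have nx : `|x| + n.+1%:R^-1 < pi.
    rewrite -ltrBrDl; near: n.
    have := @cvg_harmonic R => /cvgr_lt; exact.
  rewrite (_ : (\int[mu]_(y in E x n) ((f \_ T) y)%:E)%E = 0%E) ?mule0//.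
  rewrite -[RHS](ball_integral0 mf fi fc fs _ nx)//.
  apply: eq_integral => y; rewrite inE/= /E /ball/= => yx.
  rewrite patchE ifT// inE /torus/= in_itv/= -ler_norml.
  have -> : y = x - (x - y) by ring.
  by rewrite (le_trans (ler_normB _ _))// ltW// (lt_trans _ nx)// ltrD2l.
have e : (f x)%:E = 0%E by exact: (cvg_unique (@ereal_hausdorff R) h h0).
by case: e.
Unshelve. all: end_near. Qed.

End TrigonometricPolynomials.

(** * Limits of rapidly Cauchy sequences in L^2 *)

Section FastCauchy.
Context {R : realType}.
Local Notation mu := (@lebesgue_measure R).
Local Notation T := (@torus R).
Local Notation intg f := (mu.-integrable T (EFin \o f)).

Lemma intg_tintE (f : R -> R) : intg f -> (\int[mu]_(x in T) (f x)%:E = (tint f)%:E)%E.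
Proof.
by move=> fi; rewrite -[LHS](fineK (integrable_fin_num measurable_torus fi)).
Qed.

Variables (s : nat -> R -> R) (C : R).
Hypotheses (ms : forall j, measurable_fun setT (s j))
  (si : forall i j, intg (fun x => (s i x - s j x) ^+ 2)) (C0 : 0 <= C).
Hypothesis sC : forall i j, (j <= i)%N ->
  tint (fun x => (s i x - s j x) ^+ 2) <= C * 4^-1 ^+ j.

Let d j (x : R) := `|s j.+1 x - s j x|.

Let md j : measurable_fun setT (d j).
Proof. by apply: measurableT_comp => //; exact: measurable_funB. Qed.

(** The inequality [|z| <= 2^-j + 2^j z^2] turns the squared bound [C 4^-j] into an L^1 bound that
    is summable in [j]. *)
Let d_integral j :
  (\int[mu]_(x in T) (d j x)%:E <= ((2 * pi + C) * 2^-1 ^+ j)%:E)%E.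
Proof.
have h0 : 0 <= 2^-1 ^+ j :> R by rewrite exprn_ge0.
have h1 : 0 <= 2 ^+ j :> R by rewrite exprn_ge0.
have h12 : 2^-1 ^+ j * 2 ^+ j = 1 :> R by rewrite -exprMn mulVf// expr1n.
have intb : intg (fun x => 2^-1 ^+ j + 2 ^+ j * (s j.+1 x - s j x) ^+ 2).
  apply: intgD; last exact: intgZ.
  by apply: (@intg_bounded _ _ (2^-1 ^+ j)) => // x; rewrite ger0_norm.
rewrite (@le_trans _ _ (\int[mu]_(x in T)
    (2^-1 ^+ j + 2 ^+ j * (s j.+1 x - s j x) ^+ 2)%:E)%E)//.
  apply: ge0_le_integral => //.
  - by move=> x _; rewrite lee_fin normr_ge0.
  - by apply/measurable_EFinP; exact: (measurable_funTS (md _)).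
  - exact: measurable_int intb.
  - move=> x _; rewrite lee_fin /d; move: (s j.+1 x - s j x) => y.
    rewrite -[y ^+ 2]real_normK ?num_real//.
    move: (normr_ge0 y) h12 h0 h1; move: `|y| (2^-1 ^+ j) (2 ^+ j) => z a b z0 ab a0 b0.
    have := mulr_ge0 b0 (sqr_ge0 (a - z)).
    have -> : b * (a - z) ^+ 2 = (a * b) * a - 2 * (a * b) * z + b * z ^+ 2 by ring.
    by rewrite ab; lra.
rewrite (intg_tintE intb) lee_fin tintD; last 2 first.
- by apply: (@intg_bounded _ _ (2^-1 ^+ j)) => // x; rewrite ger0_norm.
- exact: intgZ.
rewrite tint_cst tintZ// [leRHS]mulrDl lerD2l.
rewrite (le_trans (ler_wpM2l h1 (sC (leqnSn j))))//.
rewrite mulrCA ler_wpM2l//.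
by rewrite -exprMn (_ : 2 * 4^-1 = 2^-1 :> R)//; field.
Qed.

(** The sum of the increments [d j] has finite integral, hence is finite almost everywhere; there
    the telescoping series converges absolutely. *)
Let cvg_ae : {ae mu, forall x, T x -> cvgn (s ^~ x)}.
Proof.
pose G x := (\sum_(j <oo) (d j x)%:E)%E.
have Gi : mu.-integrable T G.
  apply/integrableP; split.
    apply: ge0_emeasurable_sum => [j x _ _|j _]; first by rewrite lee_fin normr_ge0.
    by apply/measurable_EFinP; exact: (measurable_funTS (md _)).
  under eq_integral.
    move=> x _; rewrite gee0_abs; last by apply: nneseries_ge0 => n _ _; rewrite lee_fin normr_ge0.
    over.
  rewrite integral_nneseries//; last 2 first.
  - by move=> j; apply/measurable_EFinP; exact: (measurable_funTS (md _)).
  - by move=> j x _; rewrite lee_fin normr_ge0.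
  apply: (@le_lt_trans _ _ ((2 * (2 * pi + C))%:E)); last exact: ltry.
  apply: lime_le.
    by apply: is_cvg_nneseries => n _ _; apply: integral_ge0 => x _; rewrite lee_fin normr_ge0.
  apply: nearW => n.
  rewrite (@le_trans _ _ (\sum_(0 <= j < n) ((2 * pi + C) * 2^-1 ^+ j)%:E)%E)//.
    by apply: lee_sum => j _; exact: d_integral.
  rewrite sumEFin lee_fin -mulr_sumr mulrC.
  have piC : 0 <= 2 * pi + C by rewrite addr_ge0// mulr_ge0// pi_ge0.
  rewrite ler_wpM2r//.
  suff -> : \sum_(0 <= j < n) 2^-1 ^+ j = 2 - 2 * 2^-1 ^+ n :> R.
    by rewrite gerBl mulr_ge0// exprn_ge0.
  elim: n => [|n IH]; first by rewrite big_geq// expr0; ring.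
  by rewrite big_nat_recr//= IH exprS; field.
have := integrable_ae measurable_torus Gi.
apply: (@filterS _ _ ae_lebesgue_filter) => x Gx Tx; have Gfin := Gx Tx.
have h : cvgn (series (fun j => s j.+1 x - s j x)).
  apply: normed_cvg; apply: nondecreasing_is_cvgn.
    by apply: nondecreasing_series => k _ _; exact: normr_ge0.
  exists (fine (G x)) => _ [n _ <-].
  rewrite -lee_fin fineK//.
  have := @nneseries_lim_ge _ (fun j => (d j x)%:E) xpredT 0 n.
  by rewrite sumEFin; apply => k _ _; rewrite lee_fin normr_ge0.
have -> : s ^~ x = (fun n => series (fun j => s j.+1 x - s j x) n + s 0%N x).
  apply/funext => n; rewrite /series/= telescope_sumr// subrK//.
by apply: is_cvgD => //; exact: is_cvg_cst.
Qed.

(** Taking an upper limit at every point makes the limit measurable and lets it inherit the exact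
    symmetries of the approximants, which later yields evenness and periodicity everywhere. The
    distance estimate is Fatou's lemma. *)
Lemma fast_cauchy_limit : exists f : R -> R,
  [/\ measurable_fun setT f,
      forall x y, (forall j, s j x = s j y) -> f x = f y &
      forall j, intg (fun x => (s j x - f x) ^+ 2) /\
        tint (fun x => (s j x - f x) ^+ 2) <= C * 4^-1 ^+ j].
Proof.
pose f x := fine (limn_esup (fun j => (s j x)%:E)).
have mf : measurable_fun setT f.
  apply: measurableT_comp; first exact: fine_measurable.
  by apply: measurable_fun_limn_esup => j; exact/measurable_EFinP.
exists f; split=> //.
  by move=> x y sxy; rewrite /f; under eq_fun do rewrite sxy.
move=> j.
have mg i : measurable_fun setT (fun x => ((s j x - s i x) ^+ 2)%:E).
  by apply/measurable_EFinP; apply: measurable_funX; exact: measurable_funB.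
have msf : measurable_fun setT (fun x => ((s j x - f x) ^+ 2)%:E).
  by apply/measurable_EFinP; apply: measurable_funX; exact: measurable_funB.
have key : (\int[mu]_(x in T) ((s j x - f x) ^+ 2)%:E <= (C * 4^-1 ^+ j)%:E)%E.
  have -> : (\int[mu]_(x in T) ((s j x - f x) ^+ 2)%:E =
      \int[mu]_(x in T) limn_einf (fun i => ((s j x - s i x) ^+ 2)%:E))%E.
    apply: ae_eq_integral => //.
    - exact: (measurable_funTS msf).
    - rewrite /limn_einf; apply: measurableT_comp => //.
      apply: measurable_fun_limn_esup => i; apply: measurableT_comp => //.
      exact: (measurable_funTS (mg i)).
    - move: cvg_ae; apply: (@filterS _ _ ae_lebesgue_filter) => x h Tx.
      have {h} /cvg_ex[l hl] := h Tx.
      have fl : f x = l.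
        have e : (fun j => (s j x)%:E) @ \oo --> l%:E by apply: cvg_EFin => //; exact: nearW.
        by rewrite /f (cvg_limn_einf_sup e).2.
      have e : (fun i => ((s j x - s i x) ^+ 2)%:E) @ \oo --> ((s j x - f x) ^+ 2)%:E.
        apply: cvg_EFin; first exact: nearW.
        rewrite fl; under eq_fun do rewrite expr2; rewrite expr2.
        by apply: cvgM; apply: cvgB => //; exact: cvg_cst.
      by rewrite (cvg_limn_einf_sup e).1.
  apply: le_trans.
    apply: (@fatou _ _ R mu T measurable_torus
      (fun i x => ((s j x - s i x) ^+ 2)%:E)) => i.
      exact: (measurable_funTS (mg i)).
    by move=> x _; rewrite lee_fin sqr_ge0.
  rewrite limn_einf_lim; apply: lime_le; first exact: is_cvg_einfs.
  apply: nearW => n.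
  apply: (@le_trans _ _ (\int[mu]_(x in T) ((s j x - s (maxn n j) x) ^+ 2)%:E)%E).
    apply: ereal_inf_lbound; exists (maxn n j) => //=; exact: leq_maxl.
  rewrite (intg_tintE (si _ _)) lee_fin (le_trans _ (sC (leq_maxr n j)))//.
  rewrite le_eqVlt; apply/orP; left; apply/eqP/eq_tint => x.
  by rewrite -sqrrN opprB.
have fi : intg (fun x => (s j x - f x) ^+ 2).
  apply/integrableP; split.
    exact: (measurable_funTS msf).
  under eq_integral do rewrite /= ger0_norm ?sqr_ge0//.
  by apply: le_lt_trans key _; exact: ltry.
by split=> //; rewrite -lee_fin -intg_tintE.
Qed.

End FastCauchy.

(** * Cosine sums and the Riesz-Fischer theorem *)

Section CosineSeries.
Context {R : realType}.
Local Notation mu := (@lebesgue_measure R).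
Local Notation T := (@torus R).
Local Notation intg f := (mu.-integrable T (EFin \o f)).
Implicit Types (f g h : R -> R) (a b : nat -> R).

Let sin_natpi k : sin (k%:R * pi) = 0 :> R.
Proof.
elim: k => [|k IH]; first by rewrite mul0r sin0.
by rewrite -natr1 mulrDl mul1r sinDpi IH oppr0.
Qed.

Lemma tint_cos k : tint (fun x => cos (k%:R * x)) = (k == 0)%:R * (2 * pi) :> R.
Proof.
have [->|k0] := eqVneq k 0.
  rewrite mul1r -[RHS]mulr1 -tint_cst; apply: eq_tint => x.
  by rewrite mul0r cos0.
rewrite mul0r; have kR : k%:R != 0 :> R by rewrite pnatr_eq0.
pose F (x : R) := k%:R^-1 * sin (k%:R * x).
have dF (x : R) : is_derive x 1 F (cos (k%:R * x)).
  have d1 : is_derive x 1 (k%:R \*: (@id R)) (k%:R *: 1) by exact: is_deriveZ.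
  have d2 : is_derive x 1 (@sin R \o (k%:R \*: (@id R))) (cos (k%:R * x) * (k%:R *: 1)).
    exact: is_derive1_comp.
  have := is_deriveZ k%:R^-1 d2; rewrite -[k%:R^-1 *: _]/(k%:R^-1 * _) mulrCA.
  by rewrite -[k%:R *: 1]/(k%:R * 1) mulr1 mulVf// mulr1.
have pp : - pi < pi :> R by rewrite gtrN// pi_gt0.
rewrite /tint /Rintegral (@continuous_FTC2 _ _ F _ _ pp).
- rewrite /F sin_natpi mulrN sinN sin_natpi oppr0 mulr0.
  by rewrite -EFinB/= subrr.
- apply: continuous_subspaceT => x; apply: continuous_comp; last exact: continuous_cos.
  by apply: continuousM; [exact: cvg_cst|exact: cvg_id].
- have cF : continuous F.
    move=> x; apply: differentiable_continuous.
    by apply/derivable1_diffP; have [] := dF x.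
  split=> [x _||]; first by have [] := dF x.
    exact: cvg_at_right_filter (cF _).
  exact: cvg_at_left_filter (cF _).
- by move=> x _; rewrite derive1E; have [_] := dF x.
Qed.

Lemma intg_cosM f k : intg f -> intg (fun x => f x * cos (k%:R * x)).
Proof. by move=> fi; apply: intgM_trig => //; exact: trig_cos. Qed.

Lemma tint_cos_cos k m :
  tint (fun x => cos (k%:R * x) * cos (m%:R * x)) =
  pi * (((k + m)%N == 0)%:R + (k == m)%:R) :> R.
Proof.
have ic n : intg (fun x => cos (n%:R * x)).
  by apply: (@intg_bounded _ _ 1); [exact: measurable_cosM|move=> x; exact: cos_max].
rewrite (eq_tint (cosMcos k m)) tintZ; last exact: intgD.
rewrite tintD// !tint_cos.
have -> : (absdiff k m == 0) = (k == m).
  by rewrite /absdiff; apply/eqP/eqP; lia.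
by field.
Qed.

Definition cos_sum b n (x : R) := \sum_(k < n) b k * cos (k%:R * x).

Lemma measurable_cos_sum b n : measurable_fun setT (cos_sum b n).
Proof.
apply: measurable_sum => k; apply: measurable_funM => //; exact: measurable_cosM.
Qed.

Lemma cos_sum_bounded b n x : `|cos_sum b n x| <= \sum_(k < n) `|b k|.
Proof.
rewrite (le_trans (ler_norm_sum _ _ _))// ler_sum// => k _.
by rewrite normrM ler_piMr// cos_max.
Qed.

Lemma intg_cos_sum b n : intg (cos_sum b n).
Proof. exact: (intg_bounded (measurable_cos_sum b n) (cos_sum_bounded b n)). Qed.

Lemma intgM_cos_sum f b n : intg f -> intg (fun x => f x * cos_sum b n x).
Proof.
by move=> fi; apply: (intgM_bounded fi (measurable_cos_sum b n) (cos_sum_bounded b n)).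
Qed.

Lemma tintM_cos_sum f b n : intg f -> tint (fun x => f x * cos_sum b n x) =
  \sum_(k < n) b k * tint (fun x => f x * cos (k%:R * x)).
Proof.
move=> fi; have [_ h] := @tint_sum _ n (fun k x => b k * (f x * cos (k%:R * x)))
  (fun k => intgZ (b k) (intg_cosM k fi)).
transitivity (tint (fun x => \sum_(k < n) b k * (f x * cos (k%:R * x)))).
  apply: eq_tint => x; rewrite mulr_sumr; apply: eq_bigr => k _.
  by rewrite mulrCA.
by rewrite h; apply: eq_bigr => k _; rewrite tintZ//; exact: intg_cosM.
Qed.

(** All nonconstant modes have squared norm [pi], while the constant one has [2 pi]; [b 0 = 0] keeps
    the formula uniform. *)
Lemma cos_sum_coef b n m : b 0 = 0 ->
  tint (fun x => cos_sum b n x * cos (m%:R * x)) = pi * ((m < n)%N%:R * b m).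
Proof.
move=> b0; have ic : intg (fun x => cos (m%:R * x)).
  by apply: (@intg_bounded _ _ 1); [exact: measurable_cosM|move=> x; exact: cos_max].
rewrite (eq_tint (fun x => mulrC _ _)) tintM_cos_sum//.
under eq_bigr do rewrite tint_cos_cos.
elim: n => [|n IH]; first by rewrite big_ord0 mul0r mulr0.
rewrite big_ord_recr IH/= [in RHS]ltnS [in RHS]leq_eqVlt.
have [->|nm] := eqVneq m n.
  rewrite ltnn mul0r mulr0 add0r mul1r.
  have [n0|n0] := eqVneq n 0; first by rewrite n0 b0 mul0r mulr0.
  by rewrite addn_eq0 (negbTE n0) /= add0r mulr1 mulrC.
rewrite /= addr0; have [[n0 m0]|h] : (n = 0 /\ m = 0)%N \/ (m + n)%N != 0%N by lia.
  by rewrite n0 m0 b0 !(mulr0, mul0r) addr0.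
by rewrite (negbTE h) !mulr0 addr0.
Qed.

Lemma tint_cos_sum_sqr b n : b 0 = 0 ->
  tint (fun x => cos_sum b n x ^+ 2) = pi * \sum_(k < n) b k ^+ 2.
Proof.
move=> b0; transitivity (tint (fun x => cos_sum b n x * cos_sum b n x)).
  by apply: eq_tint => x.
rewrite tintM_cos_sum; last exact: intg_cos_sum.
rewrite mulr_sumr; apply: eq_bigr => k _; rewrite cos_sum_coef// ltn_ord mul1r.
by rewrite expr2; ring.
Qed.

Lemma cos_sumB b n m (x : R) : (m <= n)%N ->
  cos_sum b n x - cos_sum b m x = cos_sum (fun k => (m <= k)%N%:R * b k) n x.
Proof.
move=> mn; apply/eqP; rewrite subr_eq; apply/eqP.
rewrite /cos_sum (big_ord_widen _ (fun k => b k * cos (k%:R * x)) mn).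
rewrite [X in _ + X]big_mkcond -big_split/=; apply: eq_bigr => k _.
by case: ltnP => km; rewrite ?mul0r ?add0r ?mul1r ?addr0.
Qed.

Lemma riesz_fischer_cos b (M : R) : b 0 = 0 ->
  (forall n, \sum_(k < n) b k ^+ 2 <= M) ->
  exists (f : R -> R) (N : nat -> nat), [/\ L2per f, forall x, f (- x) = f x,
    forall j, (j <= N j)%N &
    forall j, intg (fun x => (cos_sum b (N j) x - f x) ^+ 2) /\
      tint (fun x => (cos_sum b (N j) x - f x) ^+ 2) <= pi * 4^-1 ^+ j].
Proof.
move=> b0 bM.
have tail j : exists N : nat, forall n,
    \sum_(k < n) (N <= k)%N%:R * b k ^+ 2 <= 4^-1 ^+ j.
  by apply: (@sum_tail_small _ (fun k => b k ^+ 2) M) => //; rewrite exprn_gt0.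
have [N0 hN0] := choice tail.
(* Summing the cut-offs makes [N] monotone, above [N0], and at least [j]. The tails beyond [N j] are
   then at most [4^-j], the rate required of a fast Cauchy sequence. *)
pose N j := (\sum_(i < j.+1) (N0 i).+1)%N.
have Nhomo i j : (j <= i)%N -> (N j <= N i)%N.
  move=> ji; rewrite /N (@big_ord_widen _ _ _ j.+1 i.+1 (fun i => (N0 i).+1) ji).
  rewrite big_mkcond/=.
  by apply: leq_sum => k _; case: ifP.
have NN0 j : (N0 j <= N j)%N by rewrite /N big_ord_recr/=; lia.
have Nj j : (j <= N j)%N.
  rewrite /N; elim: j => [//|j IH]; rewrite big_ord_recr/= addnS ltnS.
  by rewrite (leq_trans IH)// leq_addr.
have [||i j ji|f [mf fE fN]] := @fast_cauchy_limit _ (fun j => cos_sum b (N j)) pi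
    (fun j => measurable_cos_sum b (N j)).
- move=> i j; apply: (@intg_bounded _ _
    ((\sum_(k < N i) `|b k| + \sum_(k < N j) `|b k|) ^+ 2)).
    by apply: measurable_funX; apply: measurable_funB; exact: measurable_cos_sum.
  move=> x; rewrite normrX lerXn2r ?nnegrE ?addr_ge0 ?sumr_ge0//.
  by rewrite (le_trans (ler_normB _ _))// lerD// cos_sum_bounded.
- exact: pi_ge0.
- rewrite (eq_tint (fun x => congr1 (fun y => y ^+ 2) (cos_sumB b x (Nhomo _ _ ji)))).
  rewrite tint_cos_sum_sqr ?b0 ?mulr0// ler_wpM2l ?pi_ge0//.
  rewrite (le_trans _ (hN0 j (N i)))// ler_sum// => k _.
  rewrite exprMn ler_wpM2r ?sqr_ge0//; have := NN0 j.
  case: (leqP (N j) k) => [h1 h2|_ _]; last by rewrite expr0n.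
  by rewrite (leq_trans h2 h1) expr1n.
exists f, N; split=> //; last first.
  move=> x; apply: fE => j; apply: eq_bigr => k _.
  by rewrite mulrN cosN.
split=> //.
  move=> x; apply: fE => j; apply: eq_bigr => k _; congr (_ * _).
  have -> : (k : nat)%:R * (x + 2 * pi) = k%:R * x + pi *+ 2 *+ k.
    by rewrite -[pi *+ 2 *+ k]mulr_natl; ring.
  exact: (periodicn (@cosD2pi R)).
have fi := (fN 0%N).1.
rewrite (_ : (fun x => (f x ^+ 2)%:E) = EFin \o (fun x => f x ^+ 2))//.
apply: (@le_integrable _ _ R mu T measurable_torus _
  (EFin \o (fun x => 2 * (cos_sum b (N 0) x ^+ 2 + (cos_sum b (N 0) x - f x) ^+ 2)))).
- by apply/measurable_EFinP; apply: measurable_funTS; exact: measurable_funX.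
- move=> x _; rewrite /= lee_fin !ger0_norm ?sqr_ge0 ?mulr_ge0 ?addr_ge0 ?sqr_ge0//.
  have := sqr_ge0 (2 * cos_sum b (N 0) x - f x); lra.
- apply: intgZ; apply: intgD => //.
  apply: (@intg_bounded _ _ ((\sum_(k < N 0) `|b k|) ^+ 2)).
    by apply: measurable_funX; exact: measurable_cos_sum.
  by move=> x; rewrite normrX lerXn2r ?nnegrE ?sumr_ge0// cos_sum_bounded.
Qed.

End CosineSeries.

(** * Sobolev spaces in cosine coefficients *)

Section PowerWeights.
Context {R : realType}.

(** A telescoping substitute for the integral test. With [t = 1 / (k + 2)] it reduces to
    [1 + be t <= (1 - t)^(-be)], which follows from [exp s >= 1 + s] and [ln (1 - t) <= - t]. *)
Let powR_step (be : R) k : 0 < be ->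
  be * k.+2%:R `^ (- (be + 1)) <= k.+1%:R `^ (- be) - k.+2%:R `^ (- be).
Proof.
move=> be0.
have k1 : 0 < k.+1%:R :> R by rewrite ltr0n.
have k2 : 0 < k.+2%:R :> R by rewrite ltr0n.
have -> : k.+1%:R `^ (- be) = k.+2%:R `^ (- be) * (k.+1%:R / k.+2%:R) `^ (- be).
  rewrite -powRM ?divr_ge0 ?ltW//; congr powR.
  by rewrite mulrCA mulfV ?mulr1// gt_eqF.
have -> : k.+2%:R `^ (- (be + 1)) = k.+2%:R `^ (- be) * k.+2%:R^-1.
  rewrite opprD powRD; last by rewrite [k.+2%:R == 0]gt_eqF ?implybT.
  by rewrite powR_inv1// ltW.
have p0 := powR_gt0 (- be) k2.
suff : 1 + be * k.+2%:R^-1 <= (k.+1%:R / k.+2%:R) `^ (- be).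
  move=> /(ler_wpM2l (ltW p0)); rewrite mulrDr mulr1 lerBrDl => /(le_trans _); apply.
  by rewrite lerD2l mulrCA.
have q0 : 0 < k.+1%:R / k.+2%:R :> R by rewrite divr_gt0.
rewrite /powR gt_eqF//.
rewrite (le_trans _ (expR_ge1Dx _))// lerD2l mulNr -mulrN ler_wpM2l ?(ltW be0)//.
have e : k.+1%:R / k.+2%:R = 1 + - k.+2%:R^-1 :> R.
  by rewrite -[k.+2%:R]natr1; field; rewrite gt_eqF// natr1.
by rewrite lerNr e le_ln1Dx// ltrN2 invf_lt1// ltr1n.
Qed.

Lemma sum_powR_le (a : R) : 1 < a ->
  exists2 M : R, 0 <= M & forall n, \sum_(k < n) k%:R `^ (- a) <= M.
Proof.
move=> a1; pose be := a - 1; have be0 : 0 < be by rewrite subr_gt0.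
exists (1 + be^-1); first by rewrite addr_ge0// invr_ge0 ltW.
have p0 (k : nat) (x : R) : 0 <= k%:R `^ x by exact: powR_ge0.
have key n : \sum_(k < n.+2) k%:R `^ (- a) <= 1 + be^-1 * (1 - n.+1%:R `^ (- be)).
  elim: n => [|n IH].
    rewrite !big_ord_recr big_ord0/= add0r powR0 ?oppr_eq0; last by rewrite gt_eqF//; lra.
    by rewrite !powR1 subrr mulr0 addr0 add0r.
  rewrite big_ord_recr (le_trans (lerD IH (lexx _)))//= -addrA lerD2l.
  have := ler_wpM2l (ltW (_ : 0 < be^-1)) (powR_step n be0).
  rewrite invr_gt0 be0 => /(_ isT); rewrite mulrA mulVf ?gt_eqF// mul1r.
  by rewrite /be subrK; lra.
move=> n; rewrite (@le_trans _ _ (\sum_(k < n.+2) k%:R `^ (- a)))//.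
  by rewrite !big_ord_recr/= -addrA lerDl addr_ge0.
by rewrite (le_trans (key n))// lerD2l ler_piMr ?invr_ge0 ?(ltW be0)// gerBl.
Qed.

Definition fweight (alpha : R) (k : nat) : R := k%:R `^ (- alpha).

Lemma fweight0 alpha : 0 < alpha -> fweight alpha 0 = 0.
Proof. by move=> a0; rewrite /fweight powR0// oppr_eq0 gt_eqF. Qed.

Lemma fweightK alpha k : powR k.+1%:R alpha * fweight alpha k.+1 = 1.
Proof. by rewrite /fweight powRN mulfV// gt_eqF// powR_gt0. Qed.

Lemma fweight_sum alpha : 3^-1 < alpha ->
  exists2 U : R, 0 <= U & forall n, \sum_(k < n) fweight alpha k ^+ 4 <= U ^+ 4.
Proof.
move=> a3; have [|M M0 hM] := @sum_powR_le (4 * alpha); first by lra.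
(* Since [M <= M + 1 <= (M + 1)^4], this witness avoids extracting a fourth root. *)
exists (M + 1) => [|n]; first by rewrite addr_ge0.
rewrite (@le_trans _ _ M)//; last first.
  rewrite (@le_trans _ _ (M + 1))//; first by rewrite lerDl.
  by rewrite ler_eXnr// lerDr.
rewrite (le_trans _ (hM n))// le_eqVlt; apply/orP; left; apply/eqP/eq_bigr => k _.
by rewrite /fweight -powR_mulrn ?powR_ge0// -powRrM; congr powR; ring.
Qed.

End PowerWeights.

(** * Real Fourier coefficients *)

Section CosineCoefficients.
Context {R : realType}.
Local Notation mu := (@lebesgue_measure R).
Local Notation T := (@torus R).
Local Notation intg f := (mu.-integrable T (EFin \o f)).
Implicit Types (f g h : R -> R).

(** Normalized so that, for [m > 0], a cosine sum has its own entries as coefficients; at [m = 0]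
    this is twice the mean. *)
Definition cosc f (m : nat) : R := pi^-1 * tint (fun x => f x * cos (m%:R * x)).
Definition sinc f (m : nat) : R := pi^-1 * tint (fun x => f x * sin (m%:R * x)).

Let pi_neq0 : pi != 0 :> R. Proof. by rewrite gt_eqF// pi_gt0. Qed.

Lemma fourier_pos f n : fourier f (Posz n) =
  Complex (2^-1 * cosc f n) (- (2^-1 * sinc f n)).
Proof. by rewrite /fourier /cosc /sinc !mulrA -invfM. Qed.

Lemma intg_sinM f k : intg f -> intg (fun x => f x * sin (k%:R * x)).
Proof. by move=> fi; apply: intgM_trig => //; exact: trig_sin. Qed.

Lemma fourier_neg f n : intg f -> fourier f (Negz n) =
  Complex (2^-1 * cosc f n.+1) (2^-1 * sinc f n.+1).
Proof.
move=> fi; rewrite /fourier /cosc /sinc !mulrA -invfM; congr Complex.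
  congr (_ * _); apply: eq_tint => x.
  by rewrite NegzE mulrNz mulNr cosN.
have -> : tint (fun x => f x * sin ((Negz n)%:~R * x)) =
    -1 * tint (fun x => f x * sin (n.+1%:R * x)).
  rewrite -tintZ; last exact: intg_sinM.
  by apply: eq_tint => x; rewrite NegzE mulrNz mulNr sinN; ring.
by rewrite mulN1r mulrN opprK.
Qed.

Lemma normc_fourier f m : intg f -> Normc.normc (fourier f m) ^+ 2 =
  4^-1 * (cosc f `|m|%N ^+ 2 + sinc f `|m|%N ^+ 2).
Proof.
move=> fi; have e (a b : R) : Normc.normc (Complex a b) ^+ 2 = a ^+ 2 + b ^+ 2.
  by rewrite /= sqr_sqrtr// addr_ge0// sqr_ge0.
by case: m => n; [rewrite fourier_pos|rewrite fourier_neg//]; rewrite e/=; lra.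
Qed.

(** A real multiplier depending only on [|m|] acts separately on cosine and sine coefficients, so
    complex identities over the integers reduce to real ones over the naturals. *)
Lemma fourier_eqP f g (w : nat -> R) : intg f -> intg g ->
  (forall m : int, fourier g m = (Complex (w `|m|%N) 0) * fourier f m) <->
  (forall n, cosc g n = w n * cosc f n /\ sinc g n = w n * sinc f n).
Proof.
move=> fi gi; split=> [h n|h m].
  have := h (Posz n); rewrite !fourier_pos/= => -[].
  by rewrite !mul0r subr0 addr0 => h1 h2; split; lra.
case: m => n; [rewrite !fourier_pos/=|rewrite !fourier_neg//=];
  rewrite (h _).1 (h _).2; congr Complex; ring.
Qed.

Lemma coscD f g n : intg f -> intg g ->
  cosc (fun x => f x + g x) n = cosc f n + cosc g n.
Proof.
move=> fi gi; rewrite /cosc -mulrDr -tintD; [|exact: intg_cosM..].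
by congr (_ * _); apply: eq_tint => x; rewrite mulrDl.
Qed.

Lemma coscZ c f n : intg f -> cosc (fun x => c * f x) n = c * cosc f n.
Proof.
move=> fi; rewrite /cosc mulrCA -(tintZ c); last exact: intg_cosM.
by congr (_ * _); apply: eq_tint => x; rewrite mulrA.
Qed.

Lemma sincD f g n : intg f -> intg g ->
  sinc (fun x => f x + g x) n = sinc f n + sinc g n.
Proof.
move=> fi gi; rewrite /sinc -mulrDr -tintD; [|exact: intg_sinM..].
by congr (_ * _); apply: eq_tint => x; rewrite mulrDl.
Qed.

Lemma sincZ c f n : intg f -> sinc (fun x => c * f x) n = c * sinc f n.
Proof.
move=> fi; rewrite /sinc mulrCA -(tintZ c); last exact: intg_sinM.
by congr (_ * _); apply: eq_tint => x; rewrite mulrA.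
Qed.

Lemma coscB f g n : intg f -> intg g ->
  cosc (fun x => f x - g x) n = cosc f n - cosc g n.
Proof.
move=> fi gi; rewrite -mulN1r -coscZ// -coscD//; last exact: intgZ.
by congr cosc; apply/funext => x; rewrite mulN1r.
Qed.

Lemma sincB f g n : intg f -> intg g ->
  sinc (fun x => f x - g x) n = sinc f n - sinc g n.
Proof.
move=> fi gi; rewrite -mulN1r -sincZ// -sincD//; last exact: intgZ.
by congr sinc; apply/funext => x; rewrite mulN1r.
Qed.

Lemma cosc_cst c n : cosc (fun=> c) n = (n == 0)%:R * (2 * c).
Proof.
have ic : intg (fun x => cos (n%:R * x)).
  by apply: (@intg_bounded _ _ 1); [exact: measurable_cosM|move=> x; exact: cos_max].
rewrite /cosc tintZ// tint_cos; move: (pi : R) pi_neq0 => p p0.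
by field.
Qed.

Lemma cosc0 f : cosc f 0 = pi^-1 * tint f.
Proof. by congr (_ * _); apply: eq_tint => x; rewrite mul0r cos0 mulr1. Qed.

Lemma eqae_coef f g n : intg f -> intg g -> eqae f g ->
  cosc f n = cosc g n /\ sinc f n = sinc g n.
Proof.
move=> fi gi fg; split; congr (_ * _).
  apply: eqae_tint; [exact: intg_cosM|exact: intg_cosM|].
  by move: fg; apply: (@filterS _ _ ae_lebesgue_filter) => x h Tx; rewrite h.
apply: eqae_tint; [exact: intg_sinM|exact: intg_sinM|].
by move: fg; apply: (@filterS _ _ ae_lebesgue_filter) => x h Tx; rewrite h.
Qed.

Lemma even_sinc f n : measurable_fun setT f -> intg f -> even_ae f -> sinc f n = 0.
Proof.
move=> mf fi ef.
have sfi := intg_sinM n fi.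
have fo := intg_oppr mf fi.
have sfo : intg (fun x => f (- x) * sin (n%:R * x)) by exact: intg_sinM.
have h1 : tint (fun x => f (- x) * sin (n%:R * x)) = tint (fun x => f x * sin (n%:R * x)).
  apply: eqae_tint => //.
  by move: ef; apply: (@filterS _ _ ae_lebesgue_filter) => x h Tx; rewrite h.
have h2 : tint (fun x => f (- x) * sin (n%:R * x)) = - tint (fun x => f x * sin (n%:R * x)).
  rewrite -[RHS]mulN1r -tintZ// -(@tint_oppr _ (fun x => -1 * (f x * sin (n%:R * x)))).
  - by apply: eq_tint => x; rewrite mulrN sinN; ring.
  - by apply: measurable_funM => //; apply: measurable_funM => //; exact: measurable_sinM.
  - exact: intgZ.
have := etrans (esym h1) h2; rewrite /sinc; move: (tint _) => J JN.
by have -> : J = 0; [lra|rewrite mulr0].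
Qed.

Lemma coef_eqae f g : measurable_fun setT f -> measurable_fun setT g ->
  intg f -> intg g -> (forall n, cosc f n = cosc g n) ->
  (forall n, sinc f n = sinc g n) -> eqae f g.
Proof.
move=> mf mg fi gi hc hs.
have pV : pi^-1 != 0 :> R by rewrite invr_eq0.
have : eqae (fun x => f x - g x) (fun=> 0).
  apply: fourier_coef_uniqueness.
  - exact: measurable_funB.
  - exact: intgB.
  - move=> n; apply/eqP; rewrite -(mulrI_eq0 _ (lregP pV)); apply/eqP.
    by rewrite -/(cosc (fun x => f x - g x) n) coscB// hc subrr.
  - move=> n; apply/eqP; rewrite -(mulrI_eq0 _ (lregP pV)); apply/eqP.
    by rewrite -/(sinc (fun x => f x - g x) n) sincB// hs subrr.
by apply: (@filterS _ _ ae_lebesgue_filter) => x h Tx; apply/subr0_eq/h.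
Qed.

(** Weak convergence along a subsequence is all that is used afterwards: testing with [cos (m x)]
    identifies the coefficients of the limit, and testing with [h x * cos (m x)] those of its
    product with [h]. *)
Lemma cos_series_limit (b : nat -> R) (M : R) : b 0 = 0 ->
  (forall n, \sum_(k < n) b k ^+ 2 <= M) ->
  exists f, [/\ L2per f, forall x, f (- x) = f x & exists2 N : nat -> nat,
  forall j, (j <= N j)%N & forall g, measurable_fun setT g -> intg g ->
    intg (fun x => g x ^+ 2) ->
    tint (fun x => g x * cos_sum b (N j) x) @[j --> \oo] -->
    tint (fun x => g x * f x)].
Proof.
move=> b0 bM; have [f [N [Lf fe Nj fN]]] := riesz_fischer_cos b0 bM.
exists f; split=> //; exists N => // g mg gi g2.
have mf : measurable_fun setT f by case: Lf.
have gfi : intg (fun x => g x * f x).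
  apply: (@le_integrable _ _ R mu T measurable_torus _
    (EFin \o (fun x => g x ^+ 2 + f x ^+ 2))) => //.
  - by apply/measurable_EFinP; apply: measurable_funTS; exact: measurable_funM.
  - move=> x _; rewrite /= lee_fin [leRHS]ger0_norm ?addr_ge0 ?sqr_ge0//.
    rewrite ler_norml; have := sqr_ge0 (f x - g x); have := sqr_ge0 (f x + g x).
    by have := sqr_ge0 (f x); have := sqr_ge0 (g x); lra.
  - by apply: intgD => //; case: Lf.
pose C := pi + tint (fun x => g x ^+ 2).
(* The product is split as [|d g| <= 2^j d^2 + 2^-j g^2]; as the integral of [d^2] is at most
   [pi 4^-j], both parts are of order [2^-j]. *)
have bnd j : `|tint (fun x => g x * f x) - tint (fun x => g x * cos_sum b (N j) x)|
    <= C * 2^-1 ^+ j.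
  have sgi := intgM_cos_sum b (N j) gi.
  rewrite -tintB//; set d := fun x => cos_sum b (N j) x - f x.
  have [d2 dN] := fN j.
  have di : intg (fun x => g x * f x - g x * cos_sum b (N j) x) by exact: intgB.
  have p0 : 0 < 2^-1 ^+ j :> R by rewrite exprn_gt0.
  have q0 : 0 < 2 ^+ j :> R by rewrite exprn_gt0.
  have pq : 2^-1 ^+ j * 2 ^+ j = 1 :> R by rewrite -exprMn mulVf// expr1n.
  have Bi : intg (fun x => 2 ^+ j * d x ^+ 2 + 2^-1 ^+ j * g x ^+ 2).
    by apply: intgD; exact: intgZ.
  rewrite (@le_trans _ _ (tint (fun x => 2 ^+ j * d x ^+ 2 + 2^-1 ^+ j * g x ^+ 2)))//.
    rewrite (le_trans (le_normr_Rintegral measurable_torus di))//.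
    apply: (le_Rintegral measurable_torus (integrable_norm di) Bi) => x _ /=.
    rewrite -mulrBr -opprB mulrN normrN normrM -/(d x).
    rewrite -[d x ^+ 2]real_normK ?num_real// -[g x ^+ 2]real_normK ?num_real//.
    move: `|d x| `|g x| (normr_ge0 (d x)) (normr_ge0 (g x)) => y z y0 z0.
    move: p0 q0 pq; move: (2^-1 ^+ j) (2 ^+ j) => p q p0 q0 pq.
    have := mulr_ge0 (ltW q0) (sqr_ge0 (y - p * z)).
    have -> : q * (y - p * z) ^+ 2 =
        q * y ^+ 2 - 2 * (p * q) * (y * z) + (p * q) * p * z ^+ 2 by ring.
    rewrite pq; have := mulr_ge0 y0 z0; rewrite mulrC; lra.
  rewrite tintD ?tintZ//; [|exact: intgZ..].
  have := ler_wpM2l (ltW q0) dN.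
  have -> : 2 ^+ j * (pi * 4^-1 ^+ j) = pi * 2^-1 ^+ j :> R.
    by rewrite mulrCA -exprMn; congr (_ * _ ^+ _); field.
  by rewrite /C; lra.
apply/cvgrPdist_le => e e0.
have Ce : (fun j => C * 2^-1 ^+ j) @ \oo --> 0.
  rewrite -(mulr0 C); apply: cvgM; first exact: cvg_cst.
  by apply: cvg_expr; rewrite ger0_norm ?invr_ge0// invf_lt1// ltr1n.
move/cvgr_le : Ce => /(_ e e0); apply: filterS => j.
exact: le_trans.
Qed.

End CosineCoefficients.

Section SobolevCoefficients.
Context {R : realType}.
Local Notation mu := (@lebesgue_measure R).
Local Notation T := (@torus R).
Local Notation intg f := (mu.-integrable T (EFin \o f)).
Implicit Types (f g h : R -> R).

Lemma Hnorm_le s f (M : R) : 0 <= M -> (sobolev_sum s f <= (M ^+ 2)%:E)%E ->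
  Hnorm s f <= M.
Proof.
move=> M0 h; rewrite /Hnorm -[leRHS]ger0_norm// -sqrtr_sqr ler_wsqrtr//.
rewrite -lee_fin fineK// fin_numElt (le_lt_trans h) ?ltry// andbT.
rewrite (lt_le_trans (ltNyr 0))// esum_ge0// => m _.
by rewrite lee_fin mulr_ge0 ?powR_ge0 ?sqr_ge0.
Qed.

Lemma sobolev_sum_Hnorm s f : (sobolev_sum s f < +oo)%E ->
  sobolev_sum s f = (Hnorm s f ^+ 2)%:E.
Proof.
move=> h; have h0 : (0 <= sobolev_sum s f)%E.
  by apply: esum_ge0 => m _; rewrite lee_fin mulr_ge0 ?powR_ge0 ?sqr_ge0.
by rewrite /Hnorm sqr_sqrtr ?fine_ge0// fineK// ge0_fin_numE.
Qed.

Lemma sobolev_sum_le s f (M : R) : (forall r : seq int, uniq r ->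
    \sum_(m <- r) (1 + m%:~R ^+ 2) `^ s * Normc.normc (fourier f m) ^+ 2 <= M) ->
  (sobolev_sum s f <= M%:E)%E.
Proof.
move=> h; apply: ge_ereal_sup => _ [A [Afin _] <-].
by rewrite fsbig_finite//= sumEFin lee_fin h// finmap.fset_uniq.
Qed.

Lemma sum_le_sobolev s f (r : seq int) : uniq r ->
  ((\sum_(m <- r) (1 + m%:~R ^+ 2) `^ s * Normc.normc (fourier f m) ^+ 2)%:E
   <= sobolev_sum s f)%E.
Proof.
move=> ur; apply: esum_ge; exists [set` r].
  by split=> //; exact: finite_seq.
by rewrite -fsbig_seq// sumEFin.
Qed.

Lemma sobolev_sum_linear (s c : R) f g : intg f -> intg g ->
  (sobolev_sum s f < +oo)%E -> (sobolev_sum s g < +oo)%E ->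
  (sobolev_sum s (fun x => (c * f x + g x)%R) < +oo)%E.
Proof.
move=> fi gi fs gs; pose M := 2 * c ^+ 2 * Hnorm s f ^+ 2 + 2 * Hnorm s g ^+ 2.
apply: (@le_lt_trans _ _ M%:E); last exact: ltry.
apply: sobolev_sum_le => r ur.
have hf := sum_le_sobolev s f ur; have hg := sum_le_sobolev s g ur.
rewrite (sobolev_sum_Hnorm fs) lee_fin in hf.
rewrite (sobolev_sum_Hnorm gs) lee_fin in hg.
have c0 : 0 <= 2 * c ^+ 2 by rewrite mulr_ge0// sqr_ge0.
have h2 : 0 <= 2 :> R by [].
rewrite (le_trans _ (lerD (ler_wpM2l c0 hf) (ler_wpM2l h2 hg)))//.
rewrite !mulr_sumr -big_split/=; apply: ler_sum => m _.
have cfi : intg (fun x => c * f x) by exact: intgZ.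
rewrite !normc_fourier//; last exact: intgD.
rewrite coscD// sincD// coscZ// sincZ//.
have := powR_ge0 (1 + m%:~R ^+ 2) s; move: (_ `^ s) => p p0.
move: (cosc f _) (sinc f _) (cosc g _) (sinc g _) => a b a' b'.
rewrite -subr_ge0 [leRHS](_ : _ =
  4^-1 * (p * (c * a - a') ^+ 2 + p * (c * b - b') ^+ 2)); last by ring.
by rewrite mulr_ge0// addr_ge0// mulr_ge0// sqr_ge0.
Qed.

End SobolevCoefficients.

Section WeightedCoefficients.
Context {R : realType}.
Local Notation mu := (@lebesgue_measure R).
Local Notation T := (@torus R).
Local Notation intg f := (mu.-integrable T (EFin \o f)).
Implicit Types (f g h : R -> R).
Variables (alpha U : R).
Hypotheses (alpha0 : 0 < alpha) (alpha2 : alpha <= 2) (U0 : 0 <= U).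
Local Notation u := (fweight alpha).
Hypothesis uU : forall n, \sum_(k < n) u k ^+ 4 <= U ^+ 4.
Local Notation A := (wmul U0 uU).
Local Notation B := (wconv U0 uU).

(* [f] is even with cosine coefficients [m^-alpha x_m]; [x 0] is a dummy entry
   because [u 0 = 0] (MathComp's [0 `^ a] is [0] for [a != 0]). *)
Definition has_coef f (x : l2 R) :=
  [/\ L2per f, even_ae f & forall m, cosc f m = u m * x m].

Let u0 : u 0 = 0. Proof. exact: fweight0. Qed.

Lemma L2per_measurable f : L2per f -> measurable_fun setT f.
Proof. by case. Qed.

Lemma even_even_ae f : (forall x, f (- x) = f x) -> even_ae f.
Proof. by move=> fe; apply: aeW => x _; exact: fe. Qed.

Lemma L2per_even_sinc f n : L2per f -> even_ae f -> sinc f n = 0.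
Proof. by move=> Lf; apply: even_sinc; [exact: L2per_measurable|exact: L2per_intg]. Qed.

Let wsum (x : l2 R) n : \sum_(k < n) (u k * x k) ^+ 2 <= `|A x| ^+ 2.
Proof. exact: (l2_sum_le (A x)). Qed.

Lemma cosc_cos_series_limit (b : nat -> R) f (N : nat -> nat) : b 0 = 0 ->
  (forall j, (j <= N j)%N) ->
  (forall g, measurable_fun setT g -> intg g -> intg (fun x => g x ^+ 2) ->
    tint (fun x => g x * cos_sum b (N j) x) @[j --> \oo] -->
    tint (fun x => g x * f x)) ->
  forall m, cosc f m = b m.
Proof.
move=> b0 Nj hN m.
have mc := measurable_cosM (m%:R : R); have ic : intg (fun x => cos (m%:R * x)).
  by apply: (@intg_bounded _ _ 1) => // x; exact: cos_max.
have ic2 : intg (fun x => cos (m%:R * x) ^+ 2).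
  apply: (@intg_bounded _ _ 1); first by apply: measurable_funX; exact: measurable_cosM.
  by move=> x; rewrite normrX expr_le1// cos_max.
have := hN _ mc ic ic2.
rewrite (eq_tint (fun x => mulrC (cos (m%:R * x)) (f x))) => lim1.
have lim2 : tint (fun x => cos (m%:R * x) * cos_sum b (N j) x) @[j --> \oo] --> pi * b m.
  apply: cvg_near_cst; exists m.+1 => // j /= mj.
  rewrite (eq_tint (fun x => mulrC _ _)) cos_sum_coef// (leq_trans mj (Nj j))//.
  by rewrite mul1r.
have e : tint (fun x => f x * cos (m%:R * x)) = pi * b m.
  exact: (cvg_unique _ lim1 lim2).
by rewrite /cosc e mulKf// gt_eqF// pi_gt0.
Qed.

Lemma exists_has_coef (x : l2 R) : exists2 f, has_coef f x & forall t, f (- t) = f t.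
Proof.
have b0 : u 0 * x 0 = 0 by rewrite u0 mul0r.
have [f [Lf fe [N Nj hN]]] := @cos_series_limit _ (fun k => u k * x k) _ b0 (wsum x).
exists f => //; split=> //; first exact: even_even_ae.
exact: (@cosc_cos_series_limit (fun k => u k * x k) f N b0 Nj hN).
Qed.

Lemma has_coef_eqae f g x : has_coef f x -> has_coef g x -> eqae f g.
Proof.
move=> [Lf ef fx] [Lg eg gx]; apply: coef_eqae.
- exact: L2per_measurable.
- exact: L2per_measurable.
- exact: L2per_intg.
- exact: L2per_intg.
- by move=> n; rewrite fx gx.
- by move=> n; rewrite !L2per_even_sinc.
Qed.

Lemma has_coef_linear c f g x y : has_coef f x -> has_coef g y ->
  has_coef (fun t => c * f t + g t) (c *: x + y).
Proof.
move=> [Lf ef fx] [Lg eg gx].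
have fi := L2per_intg Lf; have gi := L2per_intg Lg.
split.
- by apply: L2perD => //; exact: L2perZ.
- move: ef eg; apply: (@filterS2 _ _ ae_lebesgue_filter) => t h1 h2 Tt.
  by rewrite h1// h2.
- move=> m; rewrite coscD//; last exact: intgZ.
  by rewrite coscZ// fx gx l2DE l2ZE; ring.
Qed.

Lemma has_coef_mean f x : has_coef f x -> tint f = 0.
Proof.
move=> [_ _ /(_ 0)]; rewrite cosc0 u0 mul0r => /eqP.
by rewrite mulf_eq0 invr_eq0 gt_eqF ?pi_gt0//= => /eqP.
Qed.

Lemma has_coef_X0 f x : has_coef f x -> X0 f.
Proof. by move=> fx; split; [case: fx|exact: has_coef_mean fx]. Qed.

Lemma L2per_mul_cos_sqr h m : L2per h ->
  intg (fun t => (h t * cos (m%:R * t)) ^+ 2).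
Proof.
move=> [mh _ h2].
rewrite (_ : _ \o _ = EFin \o (fun t => h t ^+ 2 * cos (m%:R * t) ^+ 2)); last first.
  by apply/funext => t; rewrite /= exprMn.
apply: (@intgM_bounded _ _ _ 1) => //.
  by apply: measurable_funX; exact: measurable_cosM.
by move=> t; rewrite normrX expr_le1// cos_max.
Qed.

(** Replace [f] by the limit of its cosine sums and test that limit with [h t * cos (m t)]. The
    product-to-sum formula turns each approximating integral into the two pair sums defining [B].
    The condition on [m] reflects that [B] has its mean removed. *)
Lemma cosc_mul f h x y m : has_coef f x -> has_coef h y -> (0 < m)%N ->
  cosc (fun t => f t * h t) m = B x y m.
Proof.
move=> fx hy m0.
have b0 : u 0 * x 0 = 0 by rewrite u0 mul0r.
have [f' [Lf' fe' [N Nj hN]]] := @cos_series_limit _ (fun k => u k * x k) _ b0 (wsum x).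
have fx' : has_coef f' x.
  split=> //; first exact: even_even_ae.
  exact: (@cosc_cos_series_limit (fun k => u k * x k) f' N b0 Nj hN).
case: (fx) (hy) => [Lf _ _] [Lh eh hE]; have hi := L2per_intg Lh.
have mh := L2per_measurable Lh.
have ff : eqae (fun t => f t * h t) (fun t => f' t * h t).
  move: (has_coef_eqae fx fx').
  by apply: (@filterS _ _ ae_lebesgue_filter) => t e Tt; rewrite e.
have [-> _] := eqae_coef m (L2per_intgM Lf Lh) (L2per_intgM Lf' Lh) ff.
have lim1 := hN (fun t => h t * cos (m%:R * t))
  (measurable_funM mh (measurable_cosM (m%:R : R))) (intg_cosM m hi)
  (L2per_mul_cos_sqr m Lh).
pose a k := u k * x k; pose b k := u k * y k.
have step n : tint (fun t => h t * cos (m%:R * t) * cos_sum a n t) =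
    pi * (2^-1 * (pair_sum addn a b m n + pair_sum absdiff a b m n)).
  rewrite tintM_cos_sum; last exact: intg_cosM.
  rewrite /pair_sum -big_split/= !mulr_sumr; apply: eq_bigr => k _.
  have -> : tint (fun t => h t * cos (m%:R * t) * cos (k%:R * t)) =
      2^-1 * (pi * b (k + m)%N + pi * b (absdiff k m)).
    have pE j : pi * b j = tint (fun t => h t * cos (j%:R * t)).
      by rewrite /b -hE /cosc mulrA mulfV ?mul1r// gt_eqF// pi_gt0.
    rewrite !pE -tintD; [|exact: intg_cosM..].
    rewrite -tintZ; last by apply: intgD; exact: intg_cosM.
    by apply: eq_tint => t; rewrite -mulrA [cos _ * cos _]mulrC cosMcos; ring.
  by ring.
have cv phi : @pairing_bound R phi ->
    pair_sum phi a b m @ \oo --> limn (pair_sum phi a b m).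
  move=> phiP.
  have /cvg_ex[l hl] := @pair_sum_cvg _ phi u u U U x y m phiP U0 U0 uU uU.
  by rewrite (cvg_lim _ hl).
have Noo : N j @[j --> \oo] --> \oo.
  by apply/cvgnyPge => n; exists n => // j /= nj; exact: leq_trans nj (Nj j).
have lim2 : tint (fun t => h t * cos (m%:R * t) * cos_sum a (N j) t) @[j --> \oo] -->
    pi * (2^-1 * (limn (pair_sum addn a b m) + limn (pair_sum absdiff a b m))).
  under eq_fun do rewrite step.
  apply: cvgM; first exact: cvg_cst.
  apply: cvgM; first exact: cvg_cst.
  apply: cvgD.
    exact: (cvg_comp N (pair_sum addn a b m) Noo (cv _ (@pairing_add R))).
  exact: (cvg_comp N (pair_sum absdiff a b m) Noo (cv _ (@pairing_absdiff R))).
have e : tint (fun t => h t * cos (m%:R * t) * f' t) =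
    pi * (2^-1 * (limn (pair_sum addn a b m) + limn (pair_sum absdiff a b m))).
  exact: (cvg_unique _ lim1 lim2).
rewrite /cosc (eq_tint (g := fun t => h t * cos (m%:R * t) * f' t)); last first.
  by move=> t; ring.
rewrite e mulKf; last by rewrite gt_eqF// pi_gt0.
by rewrite /B/= /cosconv gtn_eqF.
Qed.

(** Symmetry is read off from the product of the corresponding functions, so the series need no
    rearrangement. *)
Lemma wconvC x y : B x y = B y x.
Proof.
apply: l2_ext => -[//|m]; have [f fx _] := exists_has_coef x; have [h hy _] := exists_has_coef y.
rewrite -(cosc_mul fx hy)// -(cosc_mul hy fx)//; congr cosc.
by apply/funext => t; rewrite mulrC.
Qed.

End WeightedCoefficients.

(** * Sobolev norms and fractional derivatives in coefficients *)

Section WeightedSobolev.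
Context {R : realType}.
Local Notation mu := (@lebesgue_measure R).
Local Notation T := (@torus R).
Local Notation intg f := (mu.-integrable T (EFin \o f)).
Implicit Types (f g h : R -> R).

Lemma sum_absz_le (g : nat -> R) (M : R) (r : seq int) : (forall k, 0 <= g k) ->
  (forall n, \sum_(k < n) g k <= M) -> uniq r ->
  \sum_(m <- r) g `|m|%N <= 2 * M.
Proof.
move=> g0 gM ur; rewrite (bigID (fun m : int => 0 <= m))/= mulr_natl mulr2n.
have side (P : pred int) : {in P &, injective absz} ->
    \sum_(m <- r | P m) g `|m|%N <= M.
  move=> Pinj; rewrite -big_filter -(big_map absz xpredT g).
  apply: sum_uniq_le => //; rewrite map_inj_in_uniq ?filter_uniq//.
  by move=> i j; rewrite !mem_filter => /andP[Pi _] /andP[Pj _]; exact: Pinj.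
apply: lerD; apply: side => i j; rewrite /in_mem/=; lia.
Qed.

Lemma Pi0_coef g n : measurable_fun setT g -> intg g ->
  cosc (Pi0 g) n = (n != 0)%:R * cosc g n /\ sinc (Pi0 g) n = sinc g n.
Proof.
move=> mg gi; set c := (2 * pi)^-1 * tint g.
have ci : intg (fun=> c) by apply: (@intg_bounded _ _ `|c|).
rewrite /Pi0 coscB// sincB// cosc_cst; split.
  have [->|n0] := eqVneq n 0; last by rewrite mul0r mul1r subr0.
  rewrite mul1r mul0r cosc0 /c invfM -!mulrA mulVKf ?subrr//.
by rewrite (@even_sinc _ (fun=> c)) ?subr0//; exact: aeW.
Qed.

Variables (alpha U : R).
Hypotheses (alpha0 : 0 < alpha) (alpha2 : alpha <= 2) (U0 : 0 <= U).
Local Notation u := (fweight alpha).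
Hypothesis uU : forall n, \sum_(k < n) u k ^+ 4 <= U ^+ 4.
Local Notation A := (wmul U0 uU).
Local Notation B := (wconv U0 uU).
Local Notation has_coef := (has_coef alpha).

Let u0 : u 0 = 0. Proof. exact: fweight0. Qed.

(** For [k >= 1], [(1 + k^2)^alpha <= 2^alpha k^(2 alpha)], and [alpha <= 2] bounds the factor by
    [4]. This cancels the [1/4] of the complex coefficients; the two signs of [m] give one more
    factor of [2]. *)
Lemma has_coef_sobolev f (x : l2 R) : has_coef f x ->
  (sobolev_sum alpha f <= ((2 * `|x|) ^+ 2)%:E)%E.
Proof.
move=> [Lf ef fx]; have fi := L2per_intg Lf.
apply: sobolev_sum_le => r ur.
rewrite (@le_trans _ _ (\sum_(m <- r) x `|m|%N ^+ 2))//; last first.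
  rewrite (le_trans (sum_absz_le (fun k => sqr_ge0 (x k)) (l2_sum_le x) ur))//.
  by have := sqr_ge0 `|x|; rewrite exprMn; lra.
apply: ler_sum => m _; rewrite normc_fourier// fx L2per_even_sinc//.
rewrite expr0n/= addr0.
have -> : m%:~R ^+ 2 = `|m|%N%:R ^+ 2 :> R.
  by rewrite -[LHS]real_normK ?num_real// -intr_norm -abszE.
case: `|m|%N => [|k]; first by rewrite u0 mul0r expr0n/= !mulr0 sqr_ge0.
have k1 : 1 <= k.+1%:R :> R by rewrite ler1n.
have kp : 0 < k.+1%:R :> R by rewrite ltr0n.
have e : (k.+1%:R `^ alpha) ^+ 2 * u k.+1 ^+ 2 = 1 by rewrite -exprMn fweightK expr1n.
have h : (1 + k.+1%:R ^+ 2) `^ alpha <= 4 * (k.+1%:R `^ alpha) ^+ 2.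
  rewrite (@le_trans _ _ ((2 * k.+1%:R ^+ 2) `^ alpha))//.
    rewrite ge0_ler_powR ?nnegrE ?addr_ge0 ?mulr_ge0 ?sqr_ge0 ?(ltW alpha0)//.
    by have := exprn_ege1 2 k1; lra.
  rewrite powRM ?sqr_ge0// ler_pM ?powR_ge0//.
    rewrite (@le_trans _ _ (2 `^ 2))//; first by rewrite ler_powR// ler1n.
    by rewrite powR_mulrn// -natrX.
  by rewrite [in leLHS]expr2 powRM// -expr2.
have xx := sqr_ge0 (x k.+1).
rewrite (le_trans (ler_wpM2r _ h))//.
  by rewrite mulr_ge0// sqr_ge0.
have -> : 4 * (k.+1%:R `^ alpha) ^+ 2 * (4^-1 * (u k.+1 * x k.+1) ^+ 2) =
  ((k.+1%:R `^ alpha) ^+ 2 * u k.+1 ^+ 2) * x k.+1 ^+ 2 by field.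
by rewrite e mul1r.
Qed.

Lemma has_coef_Hper f (x : l2 R) : has_coef f x -> Hper alpha f.
Proof.
move=> fx; split; first by case: fx.
by rewrite (le_lt_trans (has_coef_sobolev fx))// ltry.
Qed.

Lemma has_coef_Hnorm f (x : l2 R) : has_coef f x -> Hnorm alpha f <= 2 * `|x|.
Proof. by move=> /has_coef_sobolev; apply: Hnorm_le; rewrite mulr_ge0. Qed.

Lemma coef_sum_le f n : Hper alpha f ->
  \sum_(k < n) (k%:R `^ alpha * cosc f k) ^+ 2 <= (2 * Hnorm alpha f) ^+ 2.
Proof.
move=> [Lf fs]; have fi := L2per_intg Lf.
have ur : uniq [seq Posz k | k <- iota 0 n].
  by rewrite map_inj_uniq ?iota_uniq// => i j [].
have := sum_le_sobolev alpha f ur.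
rewrite (sobolev_sum_Hnorm fs) lee_fin big_map => h.
have -> : (2 * Hnorm alpha f) ^+ 2 = 4 * Hnorm alpha f ^+ 2 by ring.
rewrite (le_trans _ (ler_wpM2l _ h))// mulr_sumr.
rewrite -(big_mkord xpredT (fun k => (k%:R `^ alpha * cosc f k) ^+ 2)).
rewrite /index_iota subn0; apply: ler_sum => k _.
rewrite normc_fourier//= exprMn.
have -> : (k%:R `^ alpha) ^+ 2 = (k%:R ^+ 2) `^ alpha :> R.
  by rewrite [in RHS]expr2 powRM// -expr2.
have h1 : (k%:R ^+ 2) `^ alpha <= (1 + k%:R ^+ 2) `^ alpha :> R.
  by rewrite ge0_ler_powR ?nnegrE ?addr_ge0 ?sqr_ge0 ?(ltW alpha0)// lerDr.
have h2 := powR_ge0 (1 + k%:R ^+ 2 : R) alpha.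
rewrite (le_trans (ler_wpM2r (sqr_ge0 _) h1))//.
have := mulr_ge0 h2 (sqr_ge0 (sinc f k)).
rewrite -[(Posz k)%:~R]/(k%:R : R); lra.
Qed.

(** Multiplying by [k^alpha] undoes the weight, so this recovers a sequence [x] with [has_coef f x],
    normalized to have entry [0] at index [0]. The default [0] makes it total, so that it can be
    applied along any family of functions. *)
Definition coefl2 f : l2 R :=
  if pselect (square_summable (fun k => k%:R `^ alpha * cosc f k)) is left h
  then mkl2 h else 0.

Lemma coefl2E f k : Hper alpha f -> coefl2 f k = k%:R `^ alpha * cosc f k.
Proof.
move=> Hf; rewrite /coefl2; case: pselect => // -[].
by exists ((2 * Hnorm alpha f) ^+ 2) => n; exact: coef_sum_le.
Qed.

Lemma coefl2_norm f : Hper alpha f -> `|coefl2 f| <= 2 * Hnorm alpha f.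
Proof.
move=> Hf; apply: l2_norm_le => [|n]; first by rewrite mulr_ge0// sqrtr_ge0.
by under eq_bigr do rewrite coefl2E//; exact: coef_sum_le.
Qed.

Lemma has_coef_coefl2 f : Hper alpha f -> even_ae f -> tint f = 0 ->
  has_coef f (coefl2 f).
Proof.
move=> Hf ef f0; split=> //; first by case: Hf.
move=> [|m]; first by rewrite u0 mul0r cosc0 f0 mulr0.
by rewrite coefl2E// mulrA [u _ * _]mulrC fweightK mul1r.
Qed.

Let dpow_coef (x : l2 R) k : k%:R `^ alpha * (u k * x k) = (k != 0)%:R * x k.
Proof.
case: k => [|k]; first by rewrite u0 !mul0r mulr0.
by rewrite mulrA fweightK.
Qed.

(** The [xget] defining [Dpow] has the intended property only once some function with these
    coefficients is exhibited. Riesz-Fischer applied to [x], with its entry at [0] removed, provides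
    one. *)
Lemma Dpow_coef f (x : l2 R) : has_coef f x ->
  L2per (Dpow alpha f) /\
  forall n, cosc (Dpow alpha f) n = (n != 0)%:R * x n /\ sinc (Dpow alpha f) n = 0.
Proof.
move=> [Lf ef fx]; have fi := L2per_intg Lf.
have mE (m : int) : (`|m%:~R| `^ alpha)%:C%C =
    Complex (`|m|%N%:R `^ alpha) 0 :> R[i]%C.
  by rewrite -intr_norm -abszE.
have [g [Lg fourg]] : exists g, L2per g /\
    forall m, fourier g m = ((`|m%:~R| `^ alpha)%:C * fourier f m)%C.
  have b0 : (0%N != 0%N)%:R * x 0%N = 0 by rewrite mul0r.
  have bM n : \sum_(k < n) ((k != 0%N :> nat)%:R * x k) ^+ 2 <= `|x| ^+ 2.
    rewrite (le_trans _ (l2_sum_le x n))//; apply: ler_sum => k _.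
    by case: (_ != _); rewrite ?mul1r ?mul0r ?expr0n ?sqr_ge0.
  have [g [Lg ge [N Nj hN]]] := @cos_series_limit _ (fun k => (k != 0)%:R * x k) _ b0 bM.
  have gb := @cosc_cos_series_limit _ (fun k => (k != 0)%:R * x k) g N b0 Nj hN.
  exists g; split=> // m; rewrite mE.
  move: m; apply/(fourier_eqP (fun k => k%:R `^ alpha) fi (L2per_intg Lg)) => n.
  rewrite gb fx dpow_coef; split=> //.
  by rewrite !L2per_even_sinc ?mulr0//; exact: even_even_ae.
have [LD fD] : L2per (Dpow alpha f) /\ forall m, fourier (Dpow alpha f) m =
    ((`|m%:~R| `^ alpha)%:C * fourier f m)%C.
  by rewrite /Dpow; apply: (@xgetPex _ (fun=> 0) [set g | L2per g /\
    forall m, fourier g m = ((`|m%:~R| `^ alpha)%:C * fourier f m)%C]); exists g.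
split=> // n.
have := (fourier_eqP (fun k => k%:R `^ alpha) fi (L2per_intg LD)).1.
have h m : fourier (Dpow alpha f) m = Complex (`|m|%N%:R `^ alpha) 0 * fourier f m.
  by rewrite fD mE.
move=> /(_ h n)[-> ->]; rewrite fx dpow_coef; split=> //.
by rewrite L2per_even_sinc ?mulr0.
Qed.

End WeightedSobolev.

(** * Stationary waves *)

Section StationaryWaves.
Context {R : realType}.
Local Notation mu := (@lebesgue_measure R).
Local Notation T := (@torus R).
Local Notation intg f := (mu.-integrable T (EFin \o f)).
Implicit Types (f g h : R -> R).

Let derive1_even_cvg f t (l : R) : (forall x, f (- x) = f x) ->
  (h^-1 *: (f (h + t) - f t) @[h --> 0^'] --> l) ->
  (h^-1 *: (f (h + - t) - f (- t)) @[h --> 0^'] --> - l).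
Proof.
move=> fe /cvgrPdist_lt fl; apply/cvgrPdist_lt => e e0.
have [d /= d0 hd] := fl e e0.
exists d => // h; rewrite /ball_/= sub0r normrN => hd' h0.
have := hd (- h); rewrite /ball_/= sub0r !normrN oppr_eq0 => /(_ hd' h0).
rewrite (fe t) -(fe (h + - t)) opprD opprK invrN scaleNr.
by rewrite opprK -[- l - _]opprD normrN.
Qed.

Lemma derive1_even f t : (forall x, f (- x) = f x) ->
  derive1 f (- t) = - derive1 f t.
Proof.
move=> fe; rewrite /derive1.
have [/cvg_ex[l hl]|ncv] := pselect (cvg (h^-1 *: (f (h + t) - f t) @[h --> 0^'])).
  by rewrite (cvg_lim _ hl)// (cvg_lim _ (derive1_even_cvg fe hl)).
(* If the quotient diverges at [t] it also diverges at [- t]; both derivatives then take the default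
   value [0], compatible with oddness. *)
have ncv' : ~ cvg (h^-1 *: (f (h + - t) - f (- t)) @[h --> 0^']).
  move=> /cvg_ex[l hl]; apply: ncv; apply/cvg_ex; exists (- l).
  by have := derive1_even_cvg fe hl; rewrite opprK.
by rewrite (dvgP ncv) (dvgP ncv') oppr0.
Qed.

Section Weights.
Variables (alpha U : R).
Hypotheses (alpha0 : 0 < alpha) (alpha2 : alpha <= 2) (U0 : 0 <= U).
Local Notation u := (fweight alpha).
Hypothesis uU : forall n, \sum_(k < n) u k ^+ 4 <= U ^+ 4.
Local Notation A := (wmul U0 uU).
Local Notation B := (wconv U0 uU).
Local Notation has_coef := (has_coef alpha).

Let u0 : u 0 = 0. Proof. exact: fweight0. Qed.

Lemma quadratic_eq_coord c (x : l2 R) n :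
  quadratic_eq A B c x n = x n + c * (u n * x n) - B x x n.
Proof. by []. Qed.

(** Neither [A] nor [B] has a component at mode [0], so the equation itself fixes the dummy
    entry. *)
Lemma quadratic_eq_mean0 c (x : l2 R) : quadratic_eq A B c x = 0 -> x 0 = 0.
Proof.
move=> /(congr1 (fun y : l2 R => y 0)); rewrite quadratic_eq_coord l2_0E.
by rewrite u0 mul0r mulr0 addr0 subr0.
Qed.

Lemma even_ae_mul f h : even_ae f -> even_ae h -> even_ae (fun t => f t * h t).
Proof.
apply: (@filterS2 _ _ ae_lebesgue_filter) => t ef eh Tt.
by rewrite ef// eh.
Qed.

Lemma L2per_measurableM f h : L2per f -> L2per h ->
  measurable_fun setT (fun t => f t * h t).
Proof. by move=> [mf _ _] [mh _ _]; exact: measurable_funM. Qed.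

(** Both sides of the boundary-value problem are integrable with vanishing sine coefficients, so
    they agree almost everywhere exactly when their cosine coefficients do. At mode [0] both
    coefficients vanish, and [x 0 = 0] supplies the matching entry of the sequence equation. *)
Lemma solvesE f (x : l2 R) c : has_coef f x -> x 0 = 0 ->
  solves alpha c f <-> quadratic_eq A B c x = 0.
Proof.
move=> fx x0; case: (fx) => [Lf ef fE]; have fi := L2per_intg Lf.
have [LD DE] := Dpow_coef alpha0 fx; have Di := L2per_intg LD.
have mf := L2per_measurable Lf; have mD := L2per_measurable LD.
have ffi := L2per_intgM Lf Lf; have mff := L2per_measurableM Lf Lf.
have sqE : (fun t => f t ^+ 2) = (fun t => f t * f t).
  by apply/funext => t; rewrite expr2.
pose P t := Dpow alpha f t + c * f t; pose Q := Pi0 (fun t => f t ^+ 2).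
have cfi : intg (fun t => c * f t) by exact: intgZ.
have Pi : intg P by exact: intgD.
have mP : measurable_fun setT P.
  by apply: measurable_funD => //; exact: measurable_funM.
have Qi : intg Q.
  rewrite /Q sqE; apply: intgB => //.
  by apply: (@intg_bounded _ _ `|(2 * pi)^-1 * tint (fun t => f t * f t)|).
have mQ : measurable_fun setT Q by rewrite /Q sqE; exact: measurable_funB.
have PE n : cosc P n = (n != 0)%:R * x n + c * (u n * x n).
  by rewrite /P coscD// coscZ// (DE n).1 fE.
have Ps n : sinc P n = 0.
  by rewrite /P sincD// sincZ// (DE n).2 L2per_even_sinc// mulr0 addr0.
have QE n : cosc Q n = (n != 0)%:R * B x x n.
  rewrite /Q sqE (Pi0_coef n mff ffi).1; case: n => [|n]; first by rewrite !mul0r.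
  by rewrite (cosc_mul alpha0 U0 uU fx fx).
have Qs n : sinc Q n = 0.
  by rewrite /Q sqE (Pi0_coef n mff ffi).2 even_sinc//; exact: even_ae_mul.
split=> [[_ _ PQ]|xE].
  apply: l2_ext => n; rewrite quadratic_eq_coord l2_0E.
  have [e _] := eqae_coef n Pi Qi PQ; move: e; rewrite PE QE.
  case: n => [_|n]; first by rewrite x0 u0 !mulr0 addr0 subr0.
  by rewrite !mul1r => ->; rewrite subrr.
split; [exact: (has_coef_Hper alpha0 alpha2 fx)|exact: (has_coef_X0 alpha0 fx)|].
apply: coef_eqae => // n; last by rewrite Ps Qs.
rewrite PE QE; have /(congr1 (fun y : l2 R => y n)) := xE.
rewrite quadratic_eq_coord l2_0E => /subr0_eq <-.
by case: n => [|n]; [rewrite x0 u0 !(mul0r, mulr0) addr0|rewrite !mul1r].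
Qed.

(* [psi] is even, so its derivative is odd; the only even multiple is [0]. *)
Lemma linearization_kernel c psi (x0 x : l2 R) :
  (forall t, psi (- t) = psi t) -> has_coef psi x0 ->
  (forall f, kerLX0 alpha c psi f ->
    exists a : R, eqae f (fun t => a * derive1 psi t)) ->
  x + (c *: A x - (B x0 x + B x x0)) = 0 -> x = 0.
Proof.
move=> psie psix ker xE.
have xn n : x n + (c * (u n * x n) - (B x0 x n + B x x0 n)) = 0.
  by have := congr1 (fun y : l2 R => y n) xE.
have [f fx fe] := exists_has_coef alpha0 U0 uU x.
case: (fx) => [Lf ef fE]; have fi := L2per_intg Lf.
have [LD DE] := Dpow_coef alpha0 fx; have Di := L2per_intg LD.
case: (psix) => [Lp ep _]; have pfi := L2per_intgM Lp Lf.
have mpf := L2per_measurableM Lp Lf.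
have mf := L2per_measurable Lf; have mD := L2per_measurable LD.
pose G t := Dpow alpha f t + c * f t - 2 * (psi t * f t).
have GE : G = Lop alpha c psi f by apply/funext => t; rewrite /G /Lop mulrA.
have cfi : intg (fun t => c * f t) by exact: intgZ.
have pfi2 : intg (fun t => 2 * (psi t * f t)) by exact: intgZ.
have Dci : intg (fun t => Dpow alpha f t + c * f t) by exact: intgD.
have Gi : intg G by exact: intgB.
have mG : measurable_fun setT G.
  apply: measurable_funB; last exact: measurable_funM.
  by apply: measurable_funD => //; exact: measurable_funM.
(* Mode by mode, [Pi0] of the linearized operator at [f] has the entries of [xE], the two mixed
   convolutions merging by symmetry into the factor [2]. *)
have f0 : kerLX0 alpha c psi f.
  split; [exact: (has_coef_Hper alpha0 alpha2 fx)|exact: (has_coef_X0 alpha0 fx)|].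
  rewrite -GE.
  apply: coef_eqae => //.
  - by apply: measurable_funB.
  - apply: intgB => //.
    by apply: (@intg_bounded _ _ `|(2 * pi)^-1 * tint G|).
  - by apply: (@intg_bounded _ _ 0) => // t; rewrite normr0.
  - move=> n; rewrite (Pi0_coef n mG Gi).1 cosc_cst !mulr0.
    case: n => [|n]; first by rewrite mul0r.
    rewrite mul1r /G coscB// coscD// coscZ// coscZ// (DE _).1 mul1r fE.
    rewrite (cosc_mul alpha0 U0 uU psix fx)//.
    have := xn n.+1; rewrite (wconvC alpha0 U0 uU x x0); lra.
  - move=> n; rewrite (Pi0_coef n mG Gi).2 /G sincB// sincD// sincZ// sincZ//.
    rewrite (DE _).2 L2per_even_sinc// (@even_sinc _ (fun t => psi t * f t))//.
      rewrite even_sinc//; first by rewrite !mulr0 addr0 subr0.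
      - by apply: (@intg_bounded _ _ 0) => // t; rewrite normr0.
      - exact: aeW.
    exact: even_ae_mul.
have [a fa] := ker f f0.
have fz : eqae f (fun=> 0).
  move: fa (ae_oppr fa); apply: (@filterS2 _ _ ae_lebesgue_filter) => t h1 h2 Tt.
  have := h1 Tt; have := h2 ((torusN t).2 Tt).
  by rewrite fe derive1_even//; lra.
have zi : intg (fun=> 0 : R).
  by apply: (@intg_bounded _ _ 0) => // t; rewrite normr0.
have ux n : u n * x n = 0.
  by rewrite -fE (eqae_coef n fi zi fz).1 cosc_cst !mulr0.
apply: l2_ext => -[|n]; rewrite l2_0E.
  by have := xn 0; rewrite ux mulr0 !wconv0 addr0 subr0 addr0.
by rewrite -[x _]mul1r -(fweightK alpha n) -mulrA ux mulr0.
Qed.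

Lemma sequence_branch (c0 : R) (x0 : l2 R) : quadratic_eq A B c0 x0 = 0 ->
  (forall x, x + (c0 *: A x - (B x0 x + B x x0)) = 0 -> x = 0) ->
  forall e1 : R, 0 < e1 ->
  exists (e : R) (x dx : R -> l2 R), [/\ 0 < e <= e1, x c0 = x0,
    forall c, `|c - c0| < e -> [/\ quadratic_eq A B c (x c) = 0,
      h^-1 *: (x (c + h) - x c) @[h --> 0^'] --> dx c &
      {for c, continuous dx}] &
    forall z : R -> l2 R, z c0 = x0 ->
      (forall c, `|c - c0| < e ->
         quadratic_eq A B c (z c) = 0 /\ {for c, continuous z}) ->
      forall c, `|c - c0| < e -> z c = x c].
Proof.
move=> x0E inj e1 e10.
have Al := wmul_linear U0 uU; have Bl := wconv_linearr U0 uU.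
have Br := wconv_linearl U0 uU.
(* The finite-rank part is truncation to the first [N] modes: the coordinates serve as functionals
   and the unit sequences as vectors. *)
have [N hN] := tail_compact U0 uU c0 x0.
pose K x := c0 *: A x - (B x0 x + B x x0).
have Kl : linear K.
  move=> a x y; rewrite /K Al (linD (Bl x0)) (linZ (Bl x0)).
  rewrite (linD (Br x0)) (linZ (Br x0)) scalerDr !scalerA [c0 * a]mulrC -!scalerA.
  by rewrite scalerBr scalerDr addrACA opprD addrACA.
have ll (i : 'I_N) : linear ((fun x : l2 R => x i) : l2 R -> R^o).
  by move=> a x y.
have lL (i : 'I_N) (x : l2 R) : `|x i| <= 1 * `|x|.
  by rewrite mul1r; exact: l2_coord_le.
have q01 : 0 <= (2^-1 : R) < 1 by lra.
have [S [s [s0 Sl TS ST Ss]]] := compact_perturbation_inverse (e := l2_unit)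
  Kl ll lL q01 hN inj.
apply: (quadratic_branch Al Bl Br U0 (wmul_bound U0 uU) _ (wconv_bound U0 uU)
  x0E Sl s0 Ss TS ST) => //.
by rewrite !mulr_ge0.
Qed.

End Weights.
End StationaryWaves.

(** * Curves of functions and curves of coefficients *)

Lemma Hper_linear {R : realType} (s c : R) (f g : R -> R) :
  Hper s f -> Hper s g -> Hper s (fun t => c * f t + g t).
Proof.
move=> [Lf fs] [Lg gs]; split; first by apply: L2perD => //; exact: L2perZ.
by apply: sobolev_sum_linear => //; exact: L2per_intg.
Qed.

Lemma coefl2_linear {R : realType} (alpha c : R) (f g : R -> R) : 0 < alpha ->
  Hper alpha f -> Hper alpha g ->
  coefl2 alpha (fun t => c * f t + g t) = c *: coefl2 alpha f + coefl2 alpha g.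
Proof.
move=> alpha0 Hf Hg; apply: l2_ext => k; rewrite l2DE l2ZE.
rewrite (coefl2E alpha0 k (Hper_linear c Hf Hg)) !coefl2E//.
have fi := L2per_intg Hf.1; have gi := L2per_intg Hg.1.
by rewrite coscD ?coscZ//; [ring|exact: intgZ].
Qed.

(** Differentiability gives [F b = F c + h (D + dFc)] with [h = b - c] and remainder [D] of norm at
    most [1] near [c]. On coefficients the increment is therefore at most [|h| (2 + |coefl2 dFc|)],
    the triangle inequality being that of [l2]. *)
Lemma coefl2_continuous {R : realType} (alpha c : R) (F : R -> R -> R)
    (dFc : R -> R) : 0 < alpha ->
  (\forall b \near c, Hper alpha (F b)) -> Hper alpha dFc ->
  Hnorm alpha (fun t => h^-1 * (F (c + h) t - F c t) - dFc t)
    @[h --> 0^'] --> (0 : R) ->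
  {for c, continuous (fun b => coefl2 alpha (F b))}.
Proof.
move=> alpha0 HF HdF dF; apply/cvgrPdist_le => eps eps0.
have Hc : Hper alpha (F c) by exact: nbhs_singleton HF.
pose M := 2 + `|coefl2 alpha dFc|; have M0 : 0 < M by rewrite ltr_wpDr.
move/cvgrPdist_lt : dF => /(_ 1 ltr01)[d /= d0 hd].
near=> b.
have [->|bc] := eqVneq b c; first by rewrite subrr normr0 ltW.
have Hb : Hper alpha (F b) by near: b.
pose h := b - c; have h0 : h != 0 by rewrite subr_eq0.
have bE : c + h = b by rewrite /h addrC subrK.
have hdlt : `|h| < d.
  by rewrite /h distrC; near: b; apply: cvgr_dist_lt => //; exact: cvg_id.
pose D t := h^-1 * (F (c + h) t - F c t) - dFc t.
have HD : Hper alpha D.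
  have := Hper_linear (-1) HdF (Hper_linear (h^-1 - 1)
    (Hper_linear (-1) Hc Hb) (Hper_linear (-1) Hc Hb)).
  by congr Hper; apply/funext => t; rewrite /D bE; ring.
have D1 : Hnorm alpha D <= 1.
  have := hd h; rewrite /ball_/= !sub0r !normrN => /(_ hdlt h0).
  by rewrite ger0_norm ?sqrtr_ge0// => /ltW.
have FbE : F b = (fun t => h * (fun t => 1 * D t + dFc t) t + F c t).
  by apply/funext => t; rewrite /D bE mul1r subrK mulrA mulfV// mul1r subrK.
have -> : coefl2 alpha (F b) =
    h *: (coefl2 alpha D + coefl2 alpha dFc) + coefl2 alpha (F c).
  rewrite {1}FbE (coefl2_linear h alpha0 (Hper_linear 1 HD HdF) Hc).
  by rewrite (coefl2_linear 1 alpha0 HD HdF) scale1r.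
rewrite opprD addrCA subrr addr0 normrN normrZ.
rewrite (@le_trans _ _ (`|h| * M))//.
  rewrite ler_wpM2l// (le_trans (ler_normD _ _))// lerD2r.
  by rewrite (le_trans (coefl2_norm alpha0 HD))// ler_piMr.
rewrite -ler_pdivlMr// ltW// /h distrC; near: b.
apply: cvgr_dist_lt; first exact: cvg_id.
by rewrite divr_gt0.
Unshelve. all: end_near. Qed.

Lemma has_coefZ {R : realType} (alpha c : R) f x :
  has_coef alpha f x -> has_coef alpha (fun t => c * f t) (c *: x).
Proof.
move=> fx; have := has_coef_linear (c - 1) fx fx.
rewrite scalerBl scale1r subrK; congr has_coef.
by apply/funext => t; ring.
Qed.

Lemma has_coefB {R : realType} (alpha : R) f g x y :
  has_coef alpha f x -> has_coef alpha g y ->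
  has_coef alpha (fun t => f t - g t) (x - y).
Proof.
move=> fx gy; have := has_coef_linear (-1) gy fx.
rewrite scaleN1r [- y + x]addrC; congr has_coef.
by apply/funext => t; ring.
Qed.

Lemma has_coef_cvg0 {R : realType} (alpha : R) (T : Type) (G : set_system T)
    (D : T -> R -> R) (d : T -> l2 R) : Filter G -> 0 < alpha -> alpha <= 2 ->
  (forall h, has_coef alpha (D h) (d h)) -> d h @[h --> G] --> (0 : l2 R) ->
  Hnorm alpha (D h) @[h --> G] --> (0 : R).
Proof.
move=> FG alpha0 alpha2 Dd d0.
apply: (@squeeze_cvgr _ _ _ _ (fun=> 0) (fun h => 2 * `|d h|)).
- near=> h; rewrite sqrtr_ge0/=; exact: has_coef_Hnorm.
- exact: cvg_cst.
rewrite -[X in _ --> X](mulr0 2); apply: cvgMl_tmp.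
by rewrite -(@normr0 _ (l2 R)); exact: cvg_norm.
Unshelve. all: end_near. Qed.

Theorem lemma3p8 (R : realType) (alpha c0 : R) (psi0 : R -> R)
  (halpha : 3^-1 < alpha <= 2) (hc0 : -1 < c0)
  (hpsi0 : ground_state alpha c0 psi0)
  (hker : forall f : R -> R, L2per f ->
     (kerLX0 alpha c0 psi0 f <->
      exists a : R, eqae f (fun x => a * derive1 psi0 x))) :
  exists I : set R,
    [/\ open I, is_interval I, I `<=` [set c | -1 < c], I c0 &
    exists psi : R -> R -> R,
      even_branch alpha c0 psi0 I psi /\
      forall psi' : R -> R -> R, even_branch alpha c0 psi0 I psi' ->
        forall c, I c -> eqae (psi c) (psi' c)].
Proof.
have /andP[alpha3 alpha2] := halpha.
have alpha0 : 0 < alpha by rewrite (lt_trans _ alpha3)// invr_gt0.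
have [U U0 uU] := fweight_sum alpha3.
case: hpsi0 => _ psie _ psiS _.
(* Used for [psi0] and for every competing branch alike. *)
have solves_coef c f : solves alpha c f -> even_ae f ->
    has_coef alpha f (coefl2 alpha f) /\
    quadratic_eq (wmul U0 uU) (wconv U0 uU) c (coefl2 alpha f) = 0.
  move=> Sf ef; case: (Sf) => Hf [_ f0] _.
  have fx := has_coef_coefl2 alpha0 Hf ef f0; split=> //.
  apply/(solvesE alpha0 alpha2 U0 uU c fx) => //.
  by rewrite coefl2E// powR0 ?mul0r// gt_eqF.
have [psix x0E] := solves_coef _ _ psiS (even_even_ae psie).
set x0 := coefl2 alpha psi0 in psix x0E.
have ker f : kerLX0 alpha c0 psi0 f ->
    exists a : R, eqae f (fun x => a * derive1 psi0 x).
  by move=> kf; apply/(hker f) => //; case: kf => -[].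
have inj x := linearization_kernel alpha0 alpha2 (U0 := U0) (uU := uU) (c := c0)
  (x := x) psie psix ker.
(* Bounding the radius by [c0 + 1] keeps the interval inside the speeds above [-1]. *)
have c01 : 0 < c0 + 1 by lra.
have [e [x [dx [/andP[e0 ec] xc0 xP xuniq]]]] := sequence_branch x0E inj c01.
have Fex y : exists f, has_coef alpha f y.
  by have [f fy _] := exists_has_coef alpha0 U0 uU y; exists f.
have [F hF] := choice Fex.
exists (ball c0 e); split.
- exact: ball_open.
- by rewrite ball_itv; exact: interval_is_interval.
- by move=> c; rewrite /ball/= => /ltr_normlP[_ h]; lra.
- exact: ballxx.
have inI c : ball c0 e c -> `|c - c0| < e by rewrite /ball/= distrC.
exists (fun c => F (x c)); split; first split.
- move=> c /inI cI; have [xE _ _] := xP _ cI.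
  split; last by case: (hF (x c)).
  by apply/(solvesE alpha0 alpha2 U0 uU c (hF (x c))) => //; exact: quadratic_eq_mean0 xE.
- split=> [c cI|].
    by split; [exact: has_coef_Hper (hF _)|exact: has_coef_X0 (hF _)].
  exists (fun c => F (dx c)) => c cI; have [_ xd dxc] := xP _ (inI _ cI); split.
  + by split; [exact: has_coef_Hper (hF _)|exact: has_coef_X0 (hF _)].
  + apply: (has_coef_cvg0 _ alpha0 alpha2
      (d := fun h => h^-1 *: (x (c + h) - x c) - dx c)).
      by move=> h; apply: has_coefB (hF _); apply: has_coefZ; exact: has_coefB.
    by rewrite -(subrr (dx c)); apply: cvgB xd _; exact: cvg_cst.
  + apply: (has_coef_cvg0 _ alpha0 alpha2 (d := fun b => dx b - dx c)).
      by move=> b; exact: has_coefB.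
    by rewrite -(subrr (dx c)); apply: cvgB dxc _; exact: cvg_cst.
- rewrite xc0; exact: has_coef_eqae (hF _) psix.
move=> psi' [psiS' [psiH [dpsi psiD]] psi0'] c cI.
have zE b : ball c0 e b -> has_coef alpha (psi' b) (coefl2 alpha (psi' b)) /\
    quadratic_eq (wmul U0 uU) (wconv U0 uU) b (coefl2 alpha (psi' b)) = 0.
  by move=> /psiS'[Sb eb]; exact: solves_coef.
(* The coefficients of a competing branch form a continuous curve of solutions through [x0], so
   uniqueness for sequences applies. Agreement with [psi0] almost everywhere suffices at [c0], as
   coefficients are integrals. *)
have -> : x c = coefl2 alpha (psi' c).
  apply/esym/(xuniq (fun b => coefl2 alpha (psi' b))); [|move=> b|exact: inI].
    have c0I : ball c0 e c0 by exact: ballxx.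
    have [Hc0 _] := psiH _ c0I; have [H0 _ _] := psiS.
    apply: l2_ext => k; rewrite !coefl2E//; congr (_ * _).
    by apply: (eqae_coef k _ _ psi0').1; apply: L2per_intg; [case: Hc0|case: H0].
  have -> : (`|b - c0| < e) = (`|c0 - b| < e) by rewrite distrC.
  move=> bI; split; first exact: (zE b bI).2.
  have [[HdF _] dF _] := psiD _ bI.
  apply: coefl2_continuous alpha0 _ HdF dF.
  have : \forall d \near b, ball c0 e d by apply: open_nbhs_nbhs; split => //; exact: ball_open.
  by apply: filterS => d /psiH[].
exact: has_coef_eqae (hF _) (zE c cI).1.
Qed.
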